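(* Let $(X_j)_{j\ge1}$ be a sequence of associated, centered real random variables, let $(p(n))_{n\ge1}$ be an arbitrary sequence of non-negative integers, and let $\delta>0$. Suppose that the $X_j$ have finite $(2+\delta)$-moments. Let $\ell(n)\ge 1$, $m(n)\ge 0$, $r(n)$ be integers with $n=m(n)\ell(n)+r(n)$, $0\le r(n)<\ell(n)$ and $m(n)\to+\infty$. Assume that, as $n\to+\infty$: (L) $\ \ell(n)/n\to0$; (H0) $\ \ell(n)/(s_n')^2\to0$; (Ha) $\ \dfrac{1}{(s_n')^2}\sum_{j=1}^{m(n)}\mathrm{Var}(D_{j,n})\to1$; (Hab) $\ \dfrac{1}{(s_n')^2}\mathrm{Var}\left(\sum_{j=p(n)+m(n)\ell(n)+1}^{p(n)+n}X_j\right)\to0$; (Hb) $\ \sup_{1\le j\le m(n)}\dfrac{1}{(s_n')^2}\mathrm{Var}(D_{j,n})\to0$; (Hc) $\ \dfrac{1}{(s_n')^{2+\delta}}\sum_{j=1}^{m(n)}\mathbb{E}|D_{j,n}|^{2+\delta}\to0$. Then $S_n'/s_n'$ converges in distribution to $\mathcal N(0,1)$ as $n\to+\infty$.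
   Context: Random variables $X_1,X_2,\dots$ are associated if for every $n$ and all bounded coordinatewise non-decreasing measurable $f,g:\mathbb{R}^n\to\mathbb{R}$, $\mathrm{Cov}(f(X_1,\dots,X_n),g(X_1,\dots,X_n))\ge0$. Notation: $S_n'=\sum_{h=p(n)+1}^{n+p(n)}X_h$, $(s_n')^2=\mathrm{Var}(S_n')$ with $s_n'>0$; the block sums are $$D_{j,n}=\sum_{h=p(n)+(j-1)\ell(n)+1}^{p(n)+j\ell(n)}X_h,\quad 1\le j\le m(n).$$ *)

(* Defs.v *)
From HB Require Import structures.
From mathcomp Require Import all_boot all_order all_algebra.
From mathcomp Require Import all_classical all_reals all_analysis.
From mathcomp Require Import measurable_realfun.
Set Implicit Arguments.
Unset Strict Implicit.
Unset Printing Implicit Defensive.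
Import Order.TTheory GRing.Theory Num.Theory.
Import numFieldNormedType.Exports.
Local Open Scope classical_set_scope.
Local Open Scope ring_scope.

Definition coord_nondecreasing (R : realType) (n : nat) (f : n.-tuple R -> R) :=
  forall x y : n.-tuple R, (forall i, tnth x i <= tnth y i) -> f x <= f y.

(* The sequence is (X_j)_{j >= 1}: X 0 is a dummy that is never used.
   The sigma-algebra on n.-tuple R is the one generated by the coordinates,
   that is, the Borel sigma-algebra of R^n. *)
Definition associated (d : measure_display) (T : measurableType d)
    (R : realType) (P : probability T R) (X : nat -> {RV P >-> R}) :=
  forall (n : nat) (f g : n.-tuple R -> R),
    measurable_fun [set: n.-tuple R] f -> measurable_fun [set: n.-tuple R] g ->
    (exists M : R, forall x, `|f x| <= M) -> (exists M : R, forall x, `|g x| <= M) ->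
    coord_nondecreasing f -> coord_nondecreasing g ->
    (0 <= covariance P (fun w => f [tuple X i.+1 w | i < n])
                       (fun w => g [tuple X i.+1 w | i < n]))%E.

Section block_sum.
Context (d : measure_display) (T : measurableType d) (R : realType)
  (P : probability T R).

Definition block_sum (X : nat -> {RV P >-> R}) (a b : nat) (w : T) : R :=
  \sum_(a.+1 <= h < b.+1) X h w.

Lemma measurable_block_sum X a b : measurable_fun [set: T] (block_sum X a b).
Proof. by apply: measurable_sum. Qed.

HB.instance Definition _ X a b :=
  isMeasurableFun.Build _ _ _ _ (block_sum X a b) (measurable_block_sum X a b).

End block_sum.

Definition cvg_in_distribution (d : measure_display) (T : measurableType d)
    (R : realType) (P : probability T R) (Y : nat -> {RV P >-> R})
    (mu : probability (measurableTypeR R) R) :=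
  forall x : R, {for x, continuous (fun y : R => mu `]-oo, y]%classic)} ->
    cdf (Y n) x @[n --> \oo] --> mu `]-oo, x]%classic.

(* Main.v *)
From HB Require Import structures.
Require Import Defs.
From mathcomp Require Import all_boot all_order all_algebra.
From mathcomp Require Import all_classical all_reals all_analysis.
From mathcomp Require Import measurable_realfun.
From mathcomp Require Import ring lra zify.
Set Implicit Arguments.
Unset Strict Implicit.
Unset Printing Implicit Defensive.
Import Order.TTheory GRing.Theory Num.Theory.
Import numFieldNormedType.Exports.
Local Open Scope classical_set_scope.
Local Open Scope ring_scope.

(** The theorem is proved by Stein's method.  Write phi for the standard normal
    density and let Z be standard normal.  For h bounded with a bounded
    derivative, the equation f' w - w * f w = h w - E h(Z) has a solution f
    that is bounded together with f' and f'' ([stein_equation]).  Hence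
    E h(W) -> E h(Z) as soon as E (f' W - W * f W) -> 0, and such convergences
    give convergence of distribution functions, by squeezing an indicator of a
    half-line between logistic functions ([smooth_cvg_in_distribution]).

    Let W = S'_n / s_n = Y_1 + ... + Y_m + Rn, where the Y_j are the normalized
    block sums, with variances v_j, and Rn is the normalized incomplete block.
    Put V_j = W - Y_j and expand f at V_j in E (Y_j * f W):
      Y_j * f W = Y_j * f V_j + Y_j^2 * f' V_j + remainder.
    If Y_j and V_j were independent, the first term would have mean 0 and the
    second one mean v_j * E (f' V_j).  For associated variables both defects are
    covariances of a function of Y_j and a function of V_j.  When the functions
    are Lipschitz, such a covariance is at most the product of the Lipschitz
    constants times Cov (Y_j, V_j) ([pqd_lipschitz]): adding to a Lipschitz
    function a linear one makes it monotone.  As y^2 is not Lipschitz, it is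
    first capped at 1.  This gives [stein_block].

    The decisive point is the sum over j ([stein_sum]):
      sum_j Cov (Y_j, V_j) = Var W - Cov (Rn, W) - sum_j v_j <= 1 - sum_j v_j,
    since Cov (Rn, W) >= 0 by association, and the right-hand side tends to 0 by
    the hypothesis on the sum of the block variances.  The other errors are a
    multiple of a small parameter e, the Lindeberg tails
    E (Y_j^2; |Y_j| >= e), whose sum is bounded by that of the (2 + delta)-moments
    ([lindeberg_tail_moment]), and E Rn^2. *)

(** * Bounded solutions of Stein's equation *)

Section gaussian.
Context {R : realType}.
Local Notation phi := (normal_pdf (0 : R) 1).

Lemma phiE (x : R) : phi x = normal_peak 1 * expR (- (x ^+ 2 / 2)).
Proof.
rewrite normal_pdfE ?oner_neq0// /normal_fun subr0 expr1n.
by rewrite mulNr.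
Qed.

Lemma phi_gt0 (x : R) : 0 < phi x.
Proof. by rewrite phiE mulr_gt0 ?expR_gt0// normal_peak_gt0// oner_neq0. Qed.

Lemma phiN (x : R) : phi (- x) = phi x.
Proof. by rewrite !phiE sqrrN. Qed.

Lemma is_derive_phi (x : R) : is_derive x 1 phi (- x * phi x).
Proof.
rewrite (_ : normal_pdf (0:R) 1 = fun x => normal_peak 1 * expR (- (x ^+ 2 / 2))); last first.
  by apply/funext => y; exact: phiE.
apply: is_derive_eq.
by rewrite /GRing.scale/=; field.
Qed.

Lemma phi_cvgy : phi x @[x --> +oo] --> 0.
Proof.
apply/cvgrPdist_le => e e0.
near=> x.
rewrite sub0r normrN gtr0_norm ?phi_gt0// phiE.
have x0 : 0 < x by near: x; apply: nbhs_pinfty_gt; rewrite num_real.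
have xb : 2 * normal_peak 1 / e + 1 <= x.
  by near: x; apply: nbhs_pinfty_ge; rewrite num_real.
have p0 : 0 < normal_peak (1 : R) by rewrite normal_peak_gt0// oner_neq0.
have x1 : 1 <= x by apply: le_trans xb; rewrite lerDr divr_ge0// ltW// mulr_gt0.
rewrite expRN ler_pdivrMr ?expR_gt0// mulrC.
have h : x / 2 <= expR (x ^+ 2 / 2).
  by apply: le_trans (expR_ge1Dx _); nra.
have : 2 * normal_peak 1 / e <= x by lra.
rewrite ler_pdivrMr// => h2.
nra.
Unshelve. all: end_near.
Qed.

(** Maximum principle.  The function b w = 2 / (1 + w) satisfies
    b' w - w * b w <= -1 for w >= 0, so K * b * phi - G is nonincreasing there;
    it is nonnegative because it tends to 0 at +oo.  The usual comparison
    function 1 / w would not bound G near 0. *)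
Lemma primitive_phi_ub (G k : R -> R) (K : R) :
  (forall w : R, is_derive w 1 G (k w * phi w)) -> (forall w, - K <= k w) -> 0 <= K ->
  G x @[x --> +oo] --> 0 ->
  forall w : R, 0 <= w -> G w <= 2 * K / (1 + w) * phi w.
Proof.
move=> dG kK K0 G0 w w0.
pose H (x : R) := 2 * K / (1 + x) * phi x - G x.
pose dH (x : R) := - (2 * K) / (1 + x) ^+ 2 * phi x - x * (2 * K) / (1 + x) * phi x
   - k x * phi x.
have DH (x : R) : 0 <= x -> is_derive x 1 H (dH x).
  move=> x0.
  have x10 : 1 + x != 0 by rewrite gt_eqF// ltr_wpDr.
  have := dG x; have := is_derive_phi x => d1 d2.
  have d3 : is_derive x 1 (fun x => (1 + x)^-1) (- (1 + x) ^- 2).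
    have d4 : is_derive x 1 (fun x : R => 1 + x) 1.
      have := is_deriveD (is_derive_cst (1 : R) x 1) (is_derive_id x 1).
      by rewrite add0r.
    by have := is_deriveV x10 d4; rewrite [_ *: _]mulr1.
  rewrite /H; apply: is_derive_eq.
  by rewrite /dH /GRing.scale/=; field.
have Hdec (y : R) : w <= y -> H y <= H w.
  move=> wy.
  have hd (x : R) : w <= x -> is_derive x 1 H (dH x) by move=> wx; apply: DH; apply: le_trans wx.
  apply: (@ler0_derive1_nincr _ H w y) => //.
  - by move=> x /[!in_itv]/= /andP[/ltW wx _]; have [] := hd _ wx.
  - move=> x /[!in_itv]/= /andP[/ltW wx _]; have [_ Hx] := hd _ wx.
    rewrite derive1E Hx /dH.
    have x0 : 0 <= x by apply: le_trans wx.
    have p0 := phi_gt0 x.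
    have x10 : 0 < 1 + x by rewrite ltr_wpDr.
    have -> : - (2 * K) / (1 + x) ^+ 2 * phi x - x * (2 * K) / (1 + x) * phi x
        - k x * phi x = (- K - K * (1 + x ^+ 2) / (1 + x) ^+ 2 - k x) * phi x.
      by field; rewrite gt_eqF.
    rewrite pmulr_lle0//.
    have : 0 <= K * (1 + x ^+ 2) / (1 + x) ^+ 2.
      by rewrite divr_ge0 ?sqr_ge0// mulr_ge0// addr_ge0// sqr_ge0.
    have := kK x; lra.
  - apply: derivable_within_continuous => x /[!in_itv]/= /andP[wx _].
    by have [] := hd _ wx.
have H0 : H x @[x --> +oo] --> 0.
  rewrite -(subr0 0); apply: cvgB => //.
  apply: (@squeeze_cvgr _ _ _ _ (cst 0) (fun x => 2 * K * phi x)).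
  - near=> x.
    have x0 : 0 <= x by near: x; apply: nbhs_pinfty_ge; rewrite num_real.
    have x10 : 0 < 1 + x by rewrite ltr_wpDr.
    rewrite /= mulr_ge0 ?divr_ge0 ?mulr_ge0 ?(ltW x10) ?(ltW (phi_gt0 x))//=.
    rewrite ler_wpM2r ?(ltW (phi_gt0 x))// ler_pdivrMr// ler_peMr ?mulr_ge0//.
    by rewrite lerDl.
  - exact: cvg_cst.
  - have h : 2 * K * phi x @[x --> +oo] --> 2 * K * 0.
      by apply: cvgM; [exact: cvg_cst|exact: phi_cvgy].
    by rewrite mulr0 in h.
rewrite -subr_ge0; apply: (cvgr_to_le H0).
by near=> y; apply: Hdec; near: y; apply: nbhs_pinfty_ge; rewrite num_real.
Unshelve. all: end_near.
Qed.

(** The reflection w |-> - w preserves phi, which transfers the bound from the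
    right half-line to the left one.  The factor 1 + |w| makes both G / phi and
    w * G / phi bounded. *)
Lemma primitive_phi_bound (G k : R -> R) (K : R) :
  (forall w : R, is_derive w 1 G (k w * phi w)) -> (forall w, `|k w| <= K) ->
  G x @[x --> +oo] --> 0 -> G x @[x --> -oo] --> 0 ->
  forall w : R, (1 + `|w|) * `|G w| <= 2 * K * phi w.
Proof.
move=> dG kK Gy GNy.
have K0 : 0 <= K by apply: le_trans (kK 0).
have half (F l : R -> R) : (forall w : R, is_derive w 1 F (l w * phi w)) ->
  (forall w, `|l w| <= K) -> F x @[x --> +oo] --> 0 ->
  forall w : R, 0 <= w -> (1 + w) * `|F w| <= 2 * K * phi w.
  move=> dF lK F0 w w0.
  have w10 : 0 < 1 + w by rewrite ltr_wpDr.
  rewrite mulrC -ler_pdivlMr// mulrAC ler_norml.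
  rewrite lerNl; apply/andP; split.
    apply: (@primitive_phi_ub (fun x => - F x) (fun x => - l x) K) => //.
    - by move=> x; rewrite mulNr; apply: is_deriveN.
    - by move=> x; have := lK x; rewrite ler_norml lerN2 => /andP[].
    - by rewrite -oppr0; apply: cvgN.
  apply: (@primitive_phi_ub F l K) => //.
  by move=> x; have := lK x; rewrite ler_norml => /andP[].
move=> w; have [w0|w0] := leP 0 w.
  by rewrite ger0_norm//; apply: (half G k).
rewrite ltr0_norm// -[w in G w]opprK -phiN.
apply: (half (G \o -%R) (fun x => - k (- x))).
- move=> x; have h1 := dG (- x).
  apply: (is_derive_eq (is_derive1_comp h1 (is_deriveNid x 1))).
  by rewrite phiN [LHS]mulrN1 mulNr.
- by move=> x; rewrite normrN.
- by apply/cvgNy_compNP.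
- by rewrite oppr_ge0 ltW.
Qed.
Local Notation mu := (@lebesgue_measure R).

Lemma integrable_bounded_phi (g : R -> R) (K : R) :
  measurable_fun [set: R] g -> (forall x, `|g x| <= K) ->
  mu.-integrable [set: R] (EFin \o (fun x => g x * phi x)).
Proof.
move=> mg gK.
have K0 : 0 <= K by apply: le_trans (gK 0).
apply: (@le_integrable _ _ _ mu _ measurableT _ (fun x => K%:E * (phi x)%:E)%E).
- apply/measurable_EFinP; apply: measurable_funM => //.
  exact: measurable_normal_pdf.
- move=> x _ /=; rewrite lee_fin !normrM (ger0_norm K0).
  by rewrite ler_wpM2r.
- by apply: integrableZl => //; exact: integrable_normal_pdf.
Qed.

Lemma integrable_scale_phi (K : R) :
  mu.-integrable [set: R] (EFin \o (fun x => K * phi x)).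
Proof. exact: (@integrable_bounded_phi (cst K) `|K|). Qed.

Lemma integrable_subset_line (A : set (measurableTypeR R)) (g : R -> R) : measurable A ->
  mu.-integrable [set: R] (EFin \o g) -> mu.-integrable A (EFin \o g).
Proof. by move=> mA; exact: integrableS. Qed.

Definition gauss_mean (g : R -> R) : R := \int[mu]_x (g x * phi x).

Lemma Rintegral_phi : \int[mu]_x phi x = 1.
Proof. by rewrite /Rintegral integral_normal_pdf. Qed.

Lemma le_Rintegral_phi (A : set (measurableTypeR R)) (g : R -> R) (K : R) :
  measurable A -> measurable_fun [set: R] g -> (forall x, `|g x| <= K) ->
  `|\int[mu]_(x in A) (g x * phi x)| <= K * \int[mu]_(x in A) phi x.
Proof.
move=> mA mg gK.
have ig := integrable_subset_line mA (integrable_bounded_phi mg gK).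
have iphi := integrable_subset_line mA (@integrable_normal_pdf R 0 1).
apply: le_trans (le_normr_Rintegral mA ig) _.
rewrite -RintegralZl//.
apply: le_Rintegral => //.
- exact: (integrable_norm ig).
- exact: (integrable_subset_line mA (integrable_scale_phi K)).
- by move=> x _; rewrite normrM (gtr0_norm (phi_gt0 _)) ler_wpM2r// ltW// phi_gt0.
Qed.

Lemma gauss_mean_bound (g : R -> R) (K : R) :
  measurable_fun [set: R] g -> (forall x, `|g x| <= K) -> `|gauss_mean g| <= K.
Proof.
move=> mg gK; apply: le_trans (le_Rintegral_phi measurableT mg gK) _.
by rewrite Rintegral_phi mulr1.
Qed.

Let idR : measurableTypeR R -> R := idfun.

#[local] HB.instance Definition _ :=
  @isMeasurableFun.Build _ _ _ _ idR (@measurable_id _ _ setT).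

(** The total integral of k * phi is 0, so the primitive vanishing at -oo also
    vanishes at +oo. *)
Lemma centered_primitive (k : R -> R) (K : R) :
  continuous k -> (forall x, `|k x| <= K) -> gauss_mean k = 0 ->
  exists G : R -> R, [/\ forall w : R, is_derive w 1 G (k w * phi w),
     G x @[x --> +oo] --> 0 & G x @[x --> -oo] --> 0].
Proof.
move=> ck kK k0.
have mk : measurable_fun [set: R] k by exact: continuous_measurable_fun.
have ik := integrable_bounded_phi mk kK.
have iphi := @integrable_normal_pdf R 0 1.
pose G (x : R) := \int[mu]_(t in `]-oo, x]) (k t * phi t).
have GNy (x : R) : `|G x| <= K * fine (normal_prob (0:R) 1 `]-oo, x]).
  exact: (le_Rintegral_phi (measurable_itv _) mk kK).
have Gy (x : R) : `|G x| <= K * (1 - fine (normal_prob (0:R) 1 `]-oo, x])).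
  have split (g : R -> R) : mu.-integrable [set: R] (EFin \o g) ->
      \int[mu]_(t in `]x, +oo[) g t = \int[mu]_t g t - \int[mu]_(t in `]-oo, x]) g t.
    move=> ig; rewrite -set_itvNyy in ig *.
    by rewrite (Rintegral_itvB ig).
    have -> : 1 - fine (normal_prob (0:R) 1 `]-oo, x]) = \int[mu]_(t in `]x, +oo[) phi t.
    by rewrite split// Rintegral_phi.
  have -> : G x = - \int[mu]_(t in `]x, +oo[) (k t * phi t).
    by rewrite split// -/(gauss_mean k) k0 sub0r opprK.
  by rewrite normrN; exact: (le_Rintegral_phi (measurable_itv _) mk kK).
have cdf1 : fine (normal_prob (0:R) 1 `]-oo, x]) @[x --> +oo] --> (1 : R).
  exact: (fine_cvg (cvg_cdfy1 (idR : {RV (normal_prob 0 1) >-> R}))).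
have cdf0 : fine (normal_prob (0:R) 1 `]-oo, x]) @[x --> -oo] --> (0 : R).
  exact: (fine_cvg (cvg_cdfNy0 (idR : {RV (normal_prob 0 1) >-> R}))).
exists G; split.
- move=> w.
  have iS := integrable_subset_line (measurable_itv `]-oo, w + 1]) ik.
  have w1 : w < w + 1 by rewrite ltrDl.
  have [||dG eG] := @continuous_FTC1 R (fun x => k x * phi x) (BInfty _ true) w (w + 1) w1 iS.
  + by rewrite ltNyr.
  + by apply: cvgM; [exact: ck|exact: continuous_normal_pdf].
  + by rewrite -[k w * _]eG derive1E; apply: derivableP.
- apply: norm_cvg0; apply: (@squeeze_cvgr _ _ _ _ (cst 0)
    (fun x => K * (1 - fine (normal_prob (0:R) 1 `]-oo, x])))).
  + by apply: nearW => x /=; rewrite normr_ge0 Gy.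
  + exact: cvg_cst.
  + have h : K * (1 - fine (normal_prob (0:R) 1 `]-oo, x])) @[x --> +oo] --> K * (1 - 1).
      by apply: cvgM; [exact: cvg_cst|apply: cvgB => //; exact: cvg_cst].
    by rewrite subrr mulr0 in h.
- apply: norm_cvg0; apply: (@squeeze_cvgr _ _ _ _ (cst 0)
    (fun x => K * fine (normal_prob (0:R) 1 `]-oo, x]))).
  + by apply: nearW => x /=; rewrite normr_ge0 GNy.
  + exact: cvg_cst.
  + have h : K * fine (normal_prob (0:R) 1 `]-oo, x]) @[x --> -oo] --> K * 0.
      by apply: cvgM; [exact: cvg_cst|].
    by rewrite mulr0 in h.
Qed.

(** With k = h - gauss_mean h and G the primitive of k * phi that vanishes at
    both ends, f = G / phi solves the equation.  [primitive_phi_bound] bounds f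
    and w * f, hence f' = k + w * f.  The function f' * phi is itself the
    primitive of (h' + f) * phi that vanishes at both ends, so the same lemma
    bounds w * f', hence f'' = h' + f + w * f'. *)
Lemma stein_equation (h h' : R -> R) (K K' : R) :
  (forall w : R, is_derive w 1 h (h' w)) ->
  (forall w, `|h w| <= K) -> (forall w, `|h' w| <= K') ->
  exists (f f' f'' : R -> R) (C : R),
    [/\ forall w : R, is_derive w 1 f (f' w),
        forall w : R, is_derive w 1 f' (f'' w),
        forall w, f' w - w * f w = h w - gauss_mean h &
        forall w, [/\ `|f w| <= C, `|f' w| <= C & `|f'' w| <= C]].
Proof.
move=> dh hK hK'.
have K0 : 0 <= K by apply: le_trans (hK 0).
have K'0 : 0 <= K' by apply: le_trans (hK' 0).
have ch : continuous h.
  move=> x; apply: differentiable_continuous; apply/derivable1_diffP.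
  by have [] := dh x.
have mh : measurable_fun [set: R] h by exact: continuous_measurable_fun.
have NK := gauss_mean_bound mh hK.
pose k x := h x - gauss_mean h.
have kK x : `|k x| <= 2 * K.
  by apply: le_trans (ler_normB _ _) _; have := hK x; lra.
have ck : continuous k.
  by move=> x; apply: cvgB; [exact: ch|exact: cvg_cst].
have k0 : gauss_mean k = 0.
  rewrite /gauss_mean /k.
  under eq_Rintegral do rewrite mulrBl.
  rewrite RintegralB//; last 2 first.
  - exact: integrable_bounded_phi mh hK.
  - exact: integrable_scale_phi.
  rewrite RintegralZl//; last exact: integrable_normal_pdf.
  by rewrite Rintegral_phi mulr1 subrr.
have [G [dG Gy GNy]] := centered_primitive ck kK k0.
have Gb := primitive_phi_bound dG kK Gy GNy.
pose f x := G x / phi x.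
pose f' x := k x + x * f x.
pose f'' x := h' x + f x + x * f' x.
have df (w : R) : is_derive w 1 f (f' w).
  have p0 : phi w != 0 by rewrite gt_eqF// phi_gt0.
  have d1 := dG w; have d2 := is_deriveV p0 (is_derive_phi w).
  rewrite /f; apply: is_derive_eq.
  by rewrite /f' /f /GRing.scale/=; field.
have dk (w : R) : is_derive w 1 k (h' w).
  by apply: is_derive_eq; rewrite subr0.
have df' (w : R) : is_derive w 1 f' (f'' w).
  have d1 := df w; have d2 := dk w.
  apply: is_derive_eq.
  rewrite /f'' /GRing.scale/=; ring.
have fb w : (1 + `|w|) * `|f w| <= 4 * K.
  rewrite /f normrM mulrA (gtr0_norm (x:=(phi w)^-1)) ?invr_gt0 ?phi_gt0//.
  rewrite ler_pdivrMr ?phi_gt0//; apply: le_trans (Gb w) _.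
  by rewrite ler_wpM2r// ?(ltW (phi_gt0 _))//; lra.
have fb0 w : `|f w| <= 4 * K.
  by apply: le_trans (fb w); rewrite ler_peMl// lerDl.
have wfb w : `|w * f w| <= 4 * K.
  by rewrite normrM; apply: le_trans (fb w); rewrite ler_wpM2r// lerDr.
have f'b w : `|f' w| <= 6 * K.
  by apply: le_trans (ler_normD _ _) _; have := kK w; have := wfb w; lra.
pose G2 x := f' x * phi x.
have dG2 (w : R) : is_derive w 1 G2 ((h' w + f w) * phi w).
  have d1 := df' w; have d2 := is_derive_phi w.
  apply: is_derive_eq.
  rewrite /f'' /GRing.scale/=; ring.
(* The primitive of (h' + f) * phi is f' * phi, and it is O(phi). *)
have G2b x : `|G2 x| <= 6 * K * phi x.
  by rewrite normrM (gtr0_norm (phi_gt0 x)) ler_wpM2r// ltW// phi_gt0.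
(* Both limits are 0 because f' is bounded and phi vanishes at both ends. *)
have G2cvg (F : set_system R) : Filter F -> phi x @[x --> F] --> 0 -> G2 x @[x --> F] --> 0.
  move=> FF phi0; apply: norm_cvg0.
  apply: (@squeeze_cvgr _ _ _ _ (cst 0) (fun x => 6 * K * phi x)).
  - by apply: nearW => x /=; rewrite normr_ge0 G2b.
  - exact: cvg_cst.
  - have h0 : 6 * K * phi x @[x --> F] --> 6 * K * 0.
      by apply: cvgM; [exact: cvg_cst|].
    by rewrite mulr0 in h0.
have G2y : G2 x @[x --> +oo] --> 0 by apply: G2cvg; exact: phi_cvgy.
have G2Ny : G2 x @[x --> -oo] --> 0.
  apply: G2cvg; apply/cvgNy_compNP.
  by under eq_fun do rewrite /= phiN; exact: phi_cvgy.
have kK2 w : `|h' w + f w| <= K' + 4 * K.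
  by apply: le_trans (ler_normD _ _) _; have := hK' w; have := fb0 w; lra.
have G2bb := primitive_phi_bound dG2 kK2 G2y G2Ny.
have wf'b w : `|w * f' w| <= 2 * (K' + 4 * K).
  rewrite -(ler_pM2r (phi_gt0 w)); apply: le_trans (G2bb w).
  rewrite /G2 !normrM (gtr0_norm (phi_gt0 w)) -mulrA.
  by rewrite ler_wpM2r ?mulr_ge0 ?(ltW (phi_gt0 w))// lerDr.
exists f, f', f'', (3 * (K' + 4 * K) + 6 * K); split => //.
- by move=> w; rewrite /f' /k; ring.
- move=> w; split.
  + by have := fb0 w; lra.
  + by have := f'b w; lra.
  + apply: le_trans (ler_normD _ _) _.
    by have := kK2 w; have := wf'b w; lra.
Qed.
End gaussian.

(** * Means and covariances of square-integrable variables *)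

Section square_integrable.
Context d (T : measurableType d) (R : realType) (P : probability T R).
Local Notation L2 := (Lfun P 2%:E).
Local Notation Ex F := (Rintegral P setT F).
Implicit Types F G H : T -> R.

Definition has_mean F := P.-integrable setT (EFin \o F).

Lemma Lfun2_measurable F : F \in L2 -> measurable_fun setT F.
Proof. by rewrite inE => /andP[]; rewrite inE. Qed.

Lemma Lfun2_of_sqr F : measurable_fun setT F ->
  has_mean (fun w => F w ^+ 2) -> F \in L2.
Proof.
move=> mF iF; rewrite inE; apply/andP; split; rewrite inE//=.
rewrite /finite_norm unlock /Lnorm poweR_lty//=.
under eq_integral => x _ do rewrite powR_mulrn// -normrX ger0_norm ?sqr_ge0//.
exact: integrable_lty.
Qed.

Lemma le_has_mean F G : measurable_fun setT F -> has_mean G ->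
  (forall w, `|F w| <= G w) -> has_mean F.
Proof.
move=> mF iG FG; apply: le_integrable iG => //; first exact/measurable_EFinP.
by move=> w _ /=; rewrite lee_fin (le_trans (FG w))// ler_norm.
Qed.

Lemma has_mean_measurable F : has_mean F -> measurable_fun setT F.
Proof. by move=> /measurable_int /measurable_EFinP. Qed.

Lemma has_meanD F G : has_mean F -> has_mean G -> has_mean (fun w => F w + G w).
Proof. exact: integrableD. Qed.

Lemma has_meanB F G : has_mean F -> has_mean G -> has_mean (fun w => F w - G w).
Proof. exact: integrableB. Qed.

Lemma has_meanZ k F : has_mean F -> has_mean (fun w => k * F w).
Proof. exact: integrableZl. Qed.

Lemma has_mean_norm F : has_mean F -> has_mean (fun w => `|F w|).
Proof. exact: integrable_norm. Qed.

Lemma has_mean_cst k : has_mean (fun=> k).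
Proof. exact: finite_measure_integrable_cst. Qed.

Lemma has_mean_sum I (s : seq I) (Q : pred I) (F : I -> T -> R) :
  (forall i, Q i -> has_mean (F i)) -> has_mean (fun w => \sum_(i <- s | Q i) F i w).
Proof.
move=> iF; elim: s => [|i s IH].
  by under eq_fun do rewrite big_nil; exact: has_mean_cst.
under eq_fun do rewrite big_cons.
by case: (boolP (Q i)) => // Qi; apply: has_meanD => //; exact: iF.
Qed.

Lemma Lfun2_sqr F : F \in L2 -> has_mean (fun w => F w ^+ 2).
Proof. exact: Lfun2_integrable_sqr. Qed.

Lemma Lfun2_mul F G : F \in L2 -> G \in L2 -> has_mean (fun w => F w * G w).
Proof. by move=> F2 G2; apply/Lfun1_integrable; exact: Lfun2_mul_Lfun1. Qed.

Lemma Lfun2_has_mean F : F \in L2 -> has_mean F.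
Proof.
by move=> F2; apply/Lfun1_integrable/Lfun_subset12 => //; exact: fin_num_measure.
Qed.

Lemma le_Lfun2 F G : measurable_fun setT F -> G \in L2 ->
  (forall w, `|F w| <= `|G w|) -> F \in L2.
Proof.
move=> mF G2 FG; apply: Lfun2_of_sqr => //.
apply: (le_has_mean _ (Lfun2_sqr G2)); first exact: measurable_funX.
move=> w; rewrite ger0_norm ?sqr_ge0//.
by rewrite -(real_normK (num_real (F w))) -(real_normK (num_real (G w))) lerXn2r// nnegrE.
Qed.

Lemma Lfun2_bounded F k : measurable_fun setT F -> (forall w, `|F w| <= k) -> F \in L2.
Proof.
move=> mF Fk; apply: (le_Lfun2 mF (Lfun_cst P k 2)) => w /=.
by rewrite (le_trans (Fk w))// ler_norm.
Qed.

Lemma Lfun2D F G : F \in L2 -> G \in L2 -> (fun w => F w + G w) \in L2.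
Proof. by move=> F2 G2; apply: rpredD => //; rewrite lee1n. Qed.

Lemma Lfun2Z k F : F \in L2 -> (fun w => k * F w) \in L2.
Proof.
move=> F2; under eq_fun do rewrite mulrC.
by apply: (Lfun_scale k _ F2); rewrite ler1n.
Qed.

Lemma Lfun2B F G : F \in L2 -> G \in L2 -> (fun w => F w - G w) \in L2.
Proof.
move=> F2 G2; apply: Lfun2D => //; under eq_fun do rewrite -mulN1r.
exact: Lfun2Z.
Qed.

Lemma Lfun2_sum I (s : seq I) (Q : pred I) (F : I -> T -> R) :
  (forall i, Q i -> F i \in L2) -> (fun w => \sum_(i <- s | Q i) F i w) \in L2.
Proof.
move=> iF; elim: s => [|i s IH].
  by under eq_fun do rewrite big_nil; exact: Lfun_cst.
under eq_fun do rewrite big_cons.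
by case: (boolP (Q i)) => // Qi; apply: Lfun2D => //; exact: iF.
Qed.

Lemma ExD F G : has_mean F -> has_mean G -> Ex (fun w => F w + G w) = Ex F + Ex G.
Proof. exact: RintegralD. Qed.

Lemma ExB F G : has_mean F -> has_mean G -> Ex (fun w => F w - G w) = Ex F - Ex G.
Proof. exact: RintegralB. Qed.

Lemma ExZ k F : has_mean F -> Ex (fun w => k * F w) = k * Ex F.
Proof. exact: RintegralZl. Qed.

Lemma Ex_cst k : Ex (fun=> k) = k.
Proof.
rewrite Rintegral_cst// [X in fine X](_ : _ = 1%E) ?mulr1//.
exact: probability_setT.
Qed.

Lemma Ex_sum I (s : seq I) (Q : pred I) (F : I -> T -> R) :
  (forall i, Q i -> has_mean (F i)) ->
  Ex (fun w => \sum_(i <- s | Q i) F i w) = \sum_(i <- s | Q i) Ex (F i).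
Proof.
move=> iF; elim: s => [|i s IH].
  by under eq_Rintegral do rewrite big_nil; rewrite Ex_cst big_nil.
under eq_Rintegral do rewrite big_cons.
rewrite big_cons; case: (boolP (Q i)) => // Qi.
by rewrite ExD ?IH//; [exact: iF|exact: has_mean_sum].
Qed.

Lemma le_Ex F G : has_mean F -> has_mean G -> (forall w, F w <= G w) -> Ex F <= Ex G.
Proof. by move=> iF iG FG; apply: le_Rintegral. Qed.

Lemma Ex_ge0 F : (forall w, 0 <= F w) -> 0 <= Ex F.
Proof. by move=> F0; apply: Rintegral_ge0. Qed.

Lemma normr_Ex F G : has_mean F -> has_mean G -> (forall w, `|F w| <= G w) -> `|Ex F| <= Ex G.
Proof.
move=> iF iG FG; apply: le_trans (le_normr_Rintegral measurableT iF) _.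
by apply: le_Ex => //; exact: has_mean_norm.
Qed.

Lemma Ex_dominated (F_ : nat -> T -> R) F G :
  (forall n, measurable_fun setT (F_ n)) -> measurable_fun setT F ->
  (forall w, F_ ^~ w @ \oo --> F w) -> has_mean G -> (forall n w, `|F_ n w| <= G w) ->
  Ex (F_ n) @[n --> \oo] --> Ex F.
Proof.
move=> mF_ mF cF iG FG.
have [||||//|iF _ cv] := @dominated_convergence _ _ _ P setT measurableT
  (fun n => EFin \o F_ n) (EFin \o F) (EFin \o G).
- by move=> n; exact/measurable_EFinP.
- exact/measurable_EFinP.
- by apply: aeW => w _; apply: cvg_EFin; [exact: nearW|exact: cF].
- exact: iG.
- by apply: aeW => w n _ /=; rewrite lee_fin.
apply: fine_cvg.
rewrite /= fineK; first exact: cv.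
exact: integrable_fin_num.
Qed.

Definition rcov F G : R := Ex (fun w => F w * G w) - Ex F * Ex G.

Lemma rcovC F G : rcov F G = rcov G F.
Proof. by rewrite /rcov mulrC; congr (_ - _); apply: eq_Rintegral => w _; rewrite mulrC. Qed.

Lemma rcovDl F G H : F \in L2 -> G \in L2 -> H \in L2 ->
  rcov (fun w => F w + G w) H = rcov F H + rcov G H.
Proof.
move=> F2 G2 H2; rewrite /rcov.
under eq_Rintegral do rewrite mulrDl.
rewrite !ExD; try exact: Lfun2_mul; try exact: Lfun2_has_mean.
ring.
Qed.

Lemma rcovDr F G H : F \in L2 -> G \in L2 -> H \in L2 ->
  rcov H (fun w => F w + G w) = rcov H F + rcov H G.
Proof. by move=> *; rewrite rcovC rcovDl// !(rcovC H). Qed.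

Lemma rcovZl k F H : F \in L2 -> H \in L2 ->
  rcov (fun w => k * F w) H = k * rcov F H.
Proof.
move=> F2 H2; rewrite /rcov.
under eq_Rintegral do rewrite -mulrA.
rewrite !ExZ; try exact: Lfun2_mul; try exact: Lfun2_has_mean.
ring.
Qed.

Lemma rcovZr k F H : F \in L2 -> H \in L2 ->
  rcov H (fun w => k * F w) = k * rcov H F.
Proof. by move=> *; rewrite rcovC rcovZl// rcovC. Qed.

Lemma rcovBl F G H : F \in L2 -> G \in L2 -> H \in L2 ->
  rcov (fun w => F w - G w) H = rcov F H - rcov G H.
Proof.
move=> F2 G2 H2.
have -> : (fun w => F w - G w) = (fun w => F w + -1 * G w).
  by apply/funext => w; rewrite mulN1r.
by rewrite rcovDl ?rcovZl ?Lfun2Z// mulN1r.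
Qed.

Lemma rcovBr F G H : F \in L2 -> G \in L2 -> H \in L2 ->
  rcov H (fun w => F w - G w) = rcov H F - rcov H G.
Proof. by move=> *; rewrite rcovC rcovBl// !(rcovC H). Qed.

Lemma rcov_suml I (s : seq I) (Q : pred I) (F : I -> T -> R) H :
  (forall i, Q i -> F i \in L2) -> H \in L2 ->
  rcov (fun w => \sum_(i <- s | Q i) F i w) H = \sum_(i <- s | Q i) rcov (F i) H.
Proof.
move=> iF H2; elim: s => [|i s IH].
  under [X in rcov X]eq_fun do rewrite big_nil.
  rewrite big_nil /rcov; under eq_Rintegral do rewrite mul0r.
  by rewrite !Ex_cst mul0r subrr.
under [X in rcov X]eq_fun do rewrite big_cons.
rewrite big_cons; case: (boolP (Q i)) => // Qi.
by rewrite rcovDl ?IH//; [exact: iF|exact: Lfun2_sum].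
Qed.

Lemma covariance_rcov F G : F \in L2 -> G \in L2 ->
  covariance P F G = (rcov F G)%:E.
Proof.
move=> F2 G2; rewrite covarianceE; last 3 first.
- by apply/Lfun1_integrable; exact: Lfun2_has_mean.
- by apply/Lfun1_integrable; exact: Lfun2_has_mean.
- exact: Lfun2_mul_Lfun1.
rewrite unlock /rcov EFinB EFinM /Rintegral !fineK//.
- exact: integrable_fin_num (Lfun2_has_mean G2).
- exact: integrable_fin_num (Lfun2_has_mean F2).
- exact: integrable_fin_num (Lfun2_mul F2 G2).
Qed.

End square_integrable.

(** * Covariance inequalities under association *)

Section pqd.
Context d (T : measurableType d) (R : realType) (P : probability T R).
Local Notation L2 := (Lfun P 2%:E).
Local Notation Ex F := (Rintegral P setT F).
Implicit Types U V : T -> R.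

(** Positive quadrant dependence, in its functional form.  Two nonnegative
    combinations of associated variables have this property, and it is all that
    the estimates below use about association. *)
Definition pqd U V := forall a b : R -> R,
  {homo a : x y / x <= y} -> {homo b : x y / x <= y} ->
  (exists M : R, forall x, `|a x| <= M) -> (exists M : R, forall x, `|b x| <= M) ->
  0 <= rcov P (a \o U) (b \o V).

Lemma nondecreasing_comp_measurable (a : R -> R) U :
  {homo a : x y / x <= y} -> measurable_fun setT U -> measurable_fun setT (a \o U).
Proof.
by move=> ma mU; apply: measurableT_comp => //; exact: nondecreasing_measurable.
Qed.

Lemma associated_pqd (X : nat -> {RV P >-> R}) (N : nat) (c c' : nat -> R) :
  associated X -> (forall i, 0 <= c i) -> (forall i, 0 <= c' i) ->
  pqd (fun w => \sum_(i < N) c i * X i.+1 w) (fun w => \sum_(i < N) c' i * X i.+1 w).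
Proof.
move=> aX c0 c'0 a b ma mb [Ma aM] [Mb bM].
pose lin (e : nat -> R) (t : N.-tuple R) := \sum_(i < N) e i * tnth t i.
have mlin e : measurable_fun setT (lin e).
  apply: measurable_sum => i; apply: measurable_funM => //.
  exact: measurable_tnth.
have lin_le e : (forall i, 0 <= e i) -> forall x y : N.-tuple R,
    (forall i, tnth x i <= tnth y i) -> lin e x <= lin e y.
  by move=> e0 x y xy; apply: ler_sum => i _; rewrite ler_wpM2l.
have linX e w : lin e [tuple X i.+1 w | i < N] = \sum_(i < N) e i * X i.+1 w.
  by apply: eq_bigr => i _; rewrite tnth_mktuple.
have linXE (h : R -> R) e : (fun w => (h \o lin e) [tuple X i.+1 w | i < N]) =
    h \o (fun w => \sum_(i < N) e i * X i.+1 w).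
  by apply/funext => w /=; rewrite linX.
have mX e : measurable_fun setT (fun w => \sum_(i < N) e i * X i.+1 w).
  by apply: measurable_sum => i; exact: measurable_funM.
have : (0 <= covariance P (fun w => (a \o lin c) [tuple X i.+1 w | i < N])
                         (fun w => (b \o lin c') [tuple X i.+1 w | i < N]))%E.
  apply: aX.
  - by apply: measurableT_comp => //; exact: nondecreasing_measurable.
  - by apply: measurableT_comp => //; exact: nondecreasing_measurable.
  - by exists Ma => x; exact: aM.
  - by exists Mb => x; exact: bM.
  - by move=> x y xy; apply: ma; exact: lin_le.
  - by move=> x y xy; apply: mb; exact: lin_le.
rewrite !linXE covariance_rcov ?lee_fin//.
- apply: (@Lfun2_bounded _ _ _ _ _ Ma) => [|w]; last exact: aM.
  exact: nondecreasing_comp_measurable.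
- apply: (@Lfun2_bounded _ _ _ _ _ Mb) => [|w]; last exact: bM.
  exact: nondecreasing_comp_measurable.
Qed.

Definition clamp (n : nat) (x : R) : R := Num.max (- n%:R) (Num.min x n%:R).

Lemma clamp_le n x : `|clamp n x| <= n%:R.
Proof.
rewrite ler_norml /clamp le_max lexx/= ge_max ge_min lexx orbT andbT lerNl.
by rewrite (le_trans _ (ler0n _ _))// oppr_le0.
Qed.

Lemma clamp_norm n x : `|clamp n x| <= `|x|.
Proof.
have n0 : 0 <= n%:R :> R by [].
rewrite ler_norml /clamp le_max ge_max ge_min ler_norm andbT; apply/andP; split.
  apply/orP; right; rewrite le_min; apply/andP; split.
    by rewrite lerNl -normrN ler_norm.
  by rewrite (le_trans _ n0)// oppr_le0.
by rewrite (le_trans _ (normr_ge0 _))// oppr_le0.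
Qed.

Lemma clamp_homo n : {homo clamp n : x y / x <= y}.
Proof.
move=> x y xy; rewrite /clamp ge_max le_max lexx/= le_max le_min !ge_min.
by rewrite xy lexx !orbT.
Qed.

Lemma clamp_cvg x : clamp n x @[n --> \oo] --> x.
Proof.
apply: cvg_near_cst; near=> n.
have : `|x| <= n%:R by near: n; exact: nbhs_infty_ger.
rewrite ler_norml => /andP[h1 h2].
by rewrite /clamp min_l// max_r.
Unshelve. all: end_near.
Qed.

(** Truncation of a o U and b o V at level n keeps monotonicity, and dominated
    convergence lets n tend to infinity. *)
Lemma pqd_square_integrable U V (a b : R -> R) :
  pqd U V -> measurable_fun setT U -> measurable_fun setT V ->
  {homo a : x y / x <= y} -> {homo b : x y / x <= y} ->
  a \o U \in L2 -> b \o V \in L2 -> 0 <= rcov P (a \o U) (b \o V).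
Proof.
move=> UV mU mV ha hb aU bV.
have maU := Lfun2_measurable aU.
have mbV := Lfun2_measurable bV.
have mc n (F : T -> R) : measurable_fun setT F -> measurable_fun setT (clamp n \o F).
  exact: (nondecreasing_comp_measurable (@clamp_homo n)).
have cv : rcov P (clamp n \o (a \o U)) (clamp n \o (b \o V)) @[n --> \oo] -->
    rcov P (a \o U) (b \o V).
  have cvE (F : T -> R) : F \in L2 -> Ex (clamp n \o F) @[n --> \oo] --> Ex F.
    move=> F2; apply: (@Ex_dominated _ _ _ _ _ _ (fun w => `|F w|)).
    - by move=> n; apply: mc; exact: Lfun2_measurable F2.
    - exact: Lfun2_measurable F2.
    - by move=> w; exact: clamp_cvg.
    - exact/has_mean_norm/Lfun2_has_mean.
    - by move=> n w; exact: clamp_norm.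
  apply: cvgB; last by apply: cvgM; exact: cvE.
  apply: (@Ex_dominated _ _ _ _ _ _ (fun w => `|a (U w) * b (V w)|)).
  - by move=> n; apply: measurable_funM; exact: mc.
  - exact: measurable_funM.
  - by move=> w; apply: cvgM; exact: clamp_cvg.
  - exact: (has_mean_norm (Lfun2_mul aU bV)).
  - by move=> n w /=; rewrite !normrM ler_pM// clamp_norm.
apply: (cvgr_to_ge cv); apply: nearW => n.
apply: (UV (clamp n \o a) (clamp n \o b)).
- by move=> x y xy; apply: clamp_homo; exact: ha.
- by move=> x y xy; apply: clamp_homo; exact: hb.
- by exists n%:R => x; exact: clamp_le.
- by exists n%:R => x; exact: clamp_le.
Qed.

Definition lipschitz (L : R) (f : R -> R) := forall x y, `|f x - f y| <= L * `|x - y|.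

Lemma lipschitz_homo L f : lipschitz L f ->
  {homo (fun x => L * x + f x) : x y / x <= y} /\ {homo (fun x => L * x - f x) : x y / x <= y}.
Proof.
move=> fL; split => x y xy; have := fL y x.
  by rewrite [`|y - x|]ger0_norm ?subr_ge0// ler_norml => /andP[h1 h2]; nra.
by rewrite [`|y - x|]ger0_norm ?subr_ge0// ler_norml => /andP[h1 h2]; nra.
Qed.

(** A Lipschitz function is the difference of two monotone functions. *)
Lemma lipschitz_measurable L f : lipschitz L f -> measurable_fun setT f.
Proof.
move=> /lipschitz_homo[h _].
have -> : f = fun x => (L * x + f x) - L * x by apply/funext => x; rewrite addrAC subrr add0r.
by apply: measurable_funB; [exact: nondecreasing_measurable|exact: measurable_funM].
Qed.

Lemma lipschitz_Lfun2 L f U : lipschitz L f -> U \in L2 -> (fun w => f (U w)) \in L2.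
Proof.
move=> fL U2.
have mU := Lfun2_measurable U2.
apply: (@le_Lfun2 _ _ _ _ _ (fun w => `|f 0| + L * `|U w|)).
- exact: (measurableT_comp (lipschitz_measurable fL)).
- apply: Lfun2D; first exact: Lfun_cst.
  apply: Lfun2Z; apply: (@le_Lfun2 _ _ _ _ _ U) => //.
    exact: measurableT_comp.
  by move=> w; rewrite normr_id.
- move=> w; apply: le_trans (ler_norm _).
  have := fL (U w) 0; rewrite subr0 => h.
  have := ler_normD (f 0) (f (U w) - f 0).
  rewrite addrC subrK; lra.
Qed.

(** The functions L x + f x, L x - f x, M x + g x and M x - g x are all
    nondecreasing.  Expanding the four nonnegative covariances and adding them in
    pairs cancels the mixed terms and leaves L * M * Cov (U, V) plus or minus
    Cov (f U, g V). *)
Lemma pqd_lipschitz U V f g L M :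
  pqd U V -> U \in L2 -> V \in L2 -> lipschitz L f -> lipschitz M g ->
  `|rcov P (fun w => f (U w)) (fun w => g (V w))| <= L * M * rcov P U V.
Proof.
move=> UV U2 V2 fL gM.
have mU := Lfun2_measurable U2.
have mV := Lfun2_measurable V2.
have f2 := lipschitz_Lfun2 fL U2.
have g2 := lipschitz_Lfun2 gM V2.
have [f1 f1'] := lipschitz_homo fL.
have [g1 g1'] := lipschitz_homo gM.
have LU := Lfun2Z L U2.
have MV := Lfun2Z M V2.
have hpp := pqd_square_integrable UV mU mV f1 g1 (Lfun2D LU f2) (Lfun2D MV g2).
have hpm := pqd_square_integrable UV mU mV f1 g1' (Lfun2D LU f2) (Lfun2B MV g2).
have hmp := pqd_square_integrable UV mU mV f1' g1 (Lfun2B LU f2) (Lfun2D MV g2).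
have hmm := pqd_square_integrable UV mU mV f1' g1' (Lfun2B LU f2) (Lfun2B MV g2).
rewrite /comp in hpp hpm hmp hmm.
rewrite rcovDl ?rcovDr ?rcovZl ?rcovZr ?Lfun2B ?Lfun2D// in hpp.
rewrite rcovDl ?rcovBr ?rcovZl ?rcovZr ?Lfun2B ?Lfun2D// in hpm.
rewrite rcovBl ?rcovDr ?rcovZl ?rcovZr ?Lfun2B ?Lfun2D// in hmp.
rewrite rcovBl ?rcovBr ?rcovZl ?rcovZr ?Lfun2B ?Lfun2D// in hmm.
rewrite ler_norml; apply/andP; split; nra.
Qed.

End pqd.

(** * Stein's estimate for one block *)

Section taylor.
Context {R : realType}.

Lemma MVT_line (f f' : R -> R) (x y : R) : (forall w : R, is_derive w 1 f (f' w)) ->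
  exists z, f y - f x = f' z * (y - x).
Proof.
move=> df.
have cf (a b : R) : {within `[a, b], continuous f}.
  by apply: derivable_within_continuous => w _; have [] := df w.
have [xy|yx] := leP x y.
  by have [z _ ->] := MVT_segment xy (fun w _ => df w) (cf x y); exists z.
have [z _ h] := MVT_segment (ltW yx) (fun w _ => df w) (cf y x); exists z.
by rewrite -opprB h -mulrN opprB.
Qed.

Lemma derive_bounded_lipschitz (f f' : R -> R) (C : R) :
  (forall w : R, is_derive w 1 f (f' w)) -> (forall w, `|f' w| <= C) -> lipschitz C f.
Proof.
move=> df f'C x y; have [z ->] := MVT_line y x df.
by rewrite normrM ler_wpM2r.
Qed.

Lemma taylor1_le (f f' : R -> R) (C : R) (v y : R) :
  (forall w : R, is_derive w 1 f (f' w)) -> (forall w, `|f' w| <= C) -> lipschitz C f' ->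
  `|f (v + y) - f v - f' v * y| <= C * y ^+ 2 /\
  `|f (v + y) - f v - f' v * y| <= 2 * C * `|y|.
Proof.
move=> df f'C lf'; split; last first.
  apply: le_trans (ler_normB _ _) _.
  have := derive_bounded_lipschitz df f'C (v + y) v; rewrite addrAC subrr add0r.
  have := ler_wpM2r (normr_ge0 y) (f'C v); rewrite normrM; lra.
have [y0|y0] := leP 0 y.
  have cf : {within `[v, v + y], continuous f}.
    by apply: derivable_within_continuous => w _; have [] := df w.
  have vy : v <= v + y by rewrite lerDl.
  have [z + ->] := MVT_segment vy (fun w _ => df w) cf.
  rewrite in_itv/= => /andP[z1 z2]; rewrite addrAC subrr add0r -mulrBl normrM.
  rewrite (ger0_norm y0) expr2 mulrA ler_wpM2r//; apply: le_trans (lf' _ _) _.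
  have C0 : 0 <= C by apply: le_trans (f'C 0).
  rewrite ler_wpM2l// ger0_norm; lra.
have cf : {within `[v + y, v], continuous f}.
  by apply: derivable_within_continuous => w _; have [] := df w.
have vy : v + y <= v by rewrite gerDl ltW.
have [z + h] := MVT_segment vy (fun w _ => df w) cf.
rewrite in_itv/= => /andP[z1 z2].
have -> : f (v + y) - f v - f' v * y = (f' z - f' v) * y.
  by rewrite -[f (v + y) - _]opprB h; ring.
rewrite normrM -(real_normK (num_real y)) expr2 mulrA ler_wpM2r//.
apply: le_trans (lf' _ _) _.
have C0 : 0 <= C by apply: le_trans (f'C 0).
by rewrite ler_wpM2l// (ltr0_norm y0) ler_norml; apply/andP; split; lra.
Qed.

(** Replaces y^2, which is not Lipschitz; the difference is dominated by the
    Lindeberg tail at any level e <= 1. *)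
Definition capped_sqr (x : R) := Num.min `|x| 1 ^+ 2.

Lemma capped_sqr_lipschitz : lipschitz 2 capped_sqr.
Proof.
move=> x y; rewrite /capped_sqr.
have a1 (z : R) : 0 <= Num.min `|z| 1 <= 1 by rewrite le_min normr_ge0 ler01 ge_min lexx orbT.
(* The map z |-> min |z| 1 is 1-Lipschitz with values in [0, 1]. *)
have ab : `|Num.min `|x| 1 - Num.min `|y| 1| <= `|x - y|.
  have h1 : `|x| <= `|y| + `|x - y| by rewrite -lerBlDl; apply: lerB_dist.
  have h2 : `|y| <= `|x| + `|x - y| by rewrite distrC -lerBlDl; apply: lerB_dist.
  have h3 := normr_ge0 (x - y).
  by rewrite ler_norml /Num.min; do 2 case: ltP => ?; apply/andP; split; lra.
rewrite subr_sqr normrM mulrC ler_pM//.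
have /andP[? ?] := a1 x; have /andP[? ?] := a1 y.
rewrite ger0_norm; lra.
Qed.

Lemma capped_sqr_bounds (e y : R) : e <= 1 ->
  0 <= y ^+ 2 - capped_sqr y <= (if e <= `|y| then y ^+ 2 else 0).
Proof.
move=> e1; rewrite /capped_sqr /Num.min; case: ltP => h.
  rewrite real_normK ?num_real// subrr lexx/=.
  by case: ifP => // _; rewrite sqr_ge0.
rewrite (le_trans e1 h) expr1n gerBl ler01 andbT subr_ge0.
by rewrite -(real_normK (num_real y)) exprn_ege1.
Qed.

End taylor.

Section stein_block.
Context d (T : measurableType d) (R : realType) (P : probability T R).
Local Notation L2 := (Lfun P 2%:E).
Local Notation Ex F := (Rintegral P setT F).
Implicit Types U V Y : T -> R.

Definition lindeberg_tail (e : R) Y (w : T) : R := if e <= `|Y w| then Y w ^+ 2 else 0.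

Lemma lindeberg_tail_ge0 e Y w : 0 <= lindeberg_tail e Y w.
Proof. by rewrite /lindeberg_tail; case: ifP => // _; rewrite sqr_ge0. Qed.

Lemma has_mean_lindeberg_tail e Y : Y \in L2 -> has_mean P (lindeberg_tail e Y).
Proof.
move=> Y2; have mY := Lfun2_measurable Y2.
apply: (le_has_mean _ (Lfun2_sqr Y2)).
  apply: measurable_fun_ifT => //; last exact: measurable_funX.
  by apply: measurable_fun_ler => //; exact: measurableT_comp.
move=> w; rewrite ger0_norm ?lindeberg_tail_ge0// /lindeberg_tail.
by case: ifP => // _; rewrite sqr_ge0.
Qed.

(** In the independent case the left-hand side only contains the Taylor
    remainder and the change from V to V + Y in f'.  Dependence adds the
    covariances of Y with f V and of the capped square of Y with f' V, of total
    size 3 * C * Cov (Y, V). *)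
Lemma stein_block Y V (f f' : R -> R) (C e : R) :
  (forall w : R, is_derive w 1 f (f' w)) ->
  (forall w, `|f w| <= C) -> (forall w, `|f' w| <= C) -> lipschitz C f' ->
  0 < e <= 1 -> Y \in L2 -> V \in L2 -> pqd P Y V -> Ex Y = 0 ->
  Ex (fun w => Y w ^+ 2) <= 1 ->
  `| Ex (fun w => Y w * f (V w + Y w))
     - Ex (fun w => Y w ^+ 2) * Ex (fun w => f' (V w + Y w)) |
  <= C * (2 * e * Ex (fun w => Y w ^+ 2) + 3 * rcov P Y V
          + 5 * (Ex (lindeberg_tail e Y) / e)).
Proof.
move=> df fC f'C lf' /andP[e0 e1] Y2 V2 YV Y0 v1.
have C0 : 0 <= C by apply: le_trans (fC 0).
have lf := derive_bounded_lipschitz df f'C.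
have W2 := Lfun2D V2 Y2.
have fV2 := lipschitz_Lfun2 lf V2.
have fW2 := lipschitz_Lfun2 lf W2.
have f'V2 := lipschitz_Lfun2 lf' V2.
have f'W2 := lipschitz_Lfun2 lf' W2.
have iQ := has_mean_lindeberg_tail e Y2.
have iY2 := Lfun2_sqr Y2.
set v := Ex (fun w => Y w ^+ 2) in v1 *.
set q := Ex (lindeberg_tail e Y).
have v0 : 0 <= v by apply: Ex_ge0 => w; rewrite sqr_ge0.
have q0 : 0 <= q by apply: Ex_ge0 => w; exact: lindeberg_tail_ge0.
have mY := Lfun2_measurable Y2.
have mf'V := Lfun2_measurable f'V2.
have iYfW := Lfun2_mul Y2 fW2.
have iYfV := Lfun2_mul Y2 fV2.
have iY2f'V : has_mean P (fun w => Y w ^+ 2 * f' (V w)).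
  apply: (le_has_mean _ (has_meanZ C iY2)).
    by apply: measurable_funM => //; exact: measurable_funX.
  by move=> w; rewrite normrM mulrC (ger0_norm (sqr_ge0 _)) ler_wpM2r ?sqr_ge0.
have tau2 : (fun w => capped_sqr (Y w)) \in L2.
  exact: (lipschitz_Lfun2 capped_sqr_lipschitz Y2).
pose Q2 w := Y w ^+ 2 - capped_sqr (Y w).
have Q2b w : 0 <= Q2 w <= lindeberg_tail e Y w by exact: capped_sqr_bounds.
have iQ2 : has_mean P Q2 by apply: has_meanB => //; exact: Lfun2_has_mean.
have iQ2f' : has_mean P (fun w => Q2 w * f' (V w)).
  apply: (le_has_mean _ (has_meanZ C iQ2)).
    by apply: measurable_funM => //; exact: has_mean_measurable iQ2.
  move=> w; rewrite normrM mulrC; have /andP[h _] := Q2b w.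
  by rewrite (ger0_norm h) ler_wpM2r.
(* The remainder of the first-order expansion of f at V, times Y. *)
pose r1 w := Y w * f (V w + Y w) - Y w * f (V w) - Y w ^+ 2 * f' (V w).
have ir1 : has_mean P r1 by apply: has_meanB => //; exact: has_meanB.
have r1b : `|Ex r1| <= C * (e * v + 2 * q).
  have -> : C * (e * v + 2 * q) =
      Ex (fun w => C * (e * Y w ^+ 2 + 2 * lindeberg_tail e Y w)).
    rewrite ExZ ?ExD ?ExZ//; [exact: has_meanZ|exact: has_meanZ|].
    by apply: has_meanD; exact: has_meanZ.
  apply: normr_Ex => //; first by apply: has_meanZ; apply: has_meanD; exact: has_meanZ.
  move=> w; have [h1 h2] := taylor1_le (V w) (Y w) df f'C lf'.
  have -> : r1 w = Y w * (f (V w + Y w) - f (V w) - f' (V w) * Y w) by rewrite /r1; ring.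
  rewrite normrM /lindeberg_tail; have [eY|Ye] := leP e `|Y w|.
    apply: (@le_trans _ _ (2 * C * Y w ^+ 2)).
      rewrite -(real_normK (num_real (Y w))) expr2 mulrA [X in _ <= X]mulrC.
      by rewrite ler_wpM2l.
    have := mulr_ge0 (mulr_ge0 C0 (ltW e0)) (sqr_ge0 (Y w)); lra.
  rewrite mulr0 addr0; apply: (@le_trans _ _ (e * (C * Y w ^+ 2))); last by lra.
  by rewrite ler_pM// ltW.
have c1 : `|Ex (fun w => Y w * f (V w))| <= C * rcov P Y V.
  have h : lipschitz 1 (@id R) by move=> x y; rewrite mul1r.
  have := pqd_lipschitz YV Y2 V2 h lf.
  by rewrite /rcov Y0 !mul0r !subr0 mul1r.
have c2 := pqd_lipschitz YV Y2 V2 capped_sqr_lipschitz lf'.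
rewrite {1}/rcov in c2.
have q2b : 0 <= Ex Q2 <= q.
  apply/andP; split; first by apply: Ex_ge0 => w; have /andP[] := Q2b w.
  by apply: le_Ex => // w; have /andP[] := Q2b w.
have q2f : `|Ex (fun w => Q2 w * f' (V w))| <= C * Ex Q2.
  rewrite -ExZ//; apply: normr_Ex => //; first exact: has_meanZ.
  move=> w; rewrite normrM mulrC; have /andP[h _] := Q2b w.
  by rewrite (ger0_norm h) ler_wpM2r.
have f'Vb : `|Ex (fun w => f' (V w))| <= C.
  rewrite -[leRHS](Ex_cst P C); apply: normr_Ex => //.
  - exact: Lfun2_has_mean.
  - exact: has_mean_cst.
(* |Y| <= e + Y^2 / e on the tail event, and |Y| <= e outside. *)
have f'WV : `|Ex (fun w => f' (V w + Y w)) - Ex (fun w => f' (V w))| <= C * (e + q / e).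
  rewrite -ExB; [|exact: Lfun2_has_mean|exact: Lfun2_has_mean].
  have -> : C * (e + q / e) = Ex (fun w => C * (e + e^-1 * lindeberg_tail e Y w)).
    rewrite ExZ ?ExD ?ExZ ?Ex_cst//; last 3 first.
    - exact: has_mean_cst.
    - exact: has_meanZ.
    - by apply: has_meanD; [exact: has_mean_cst|exact: has_meanZ].
    by rewrite [e^-1 * _]mulrC.
  apply: normr_Ex.
  - by apply: has_meanB; exact: Lfun2_has_mean.
  - by apply: has_meanZ; apply: has_meanD; [exact: has_mean_cst|exact: has_meanZ].
  move=> w; apply: le_trans (lf' _ _) _; rewrite addrAC subrr add0r ler_wpM2l//.
  rewrite /lindeberg_tail; have [eY|Ye] := leP e `|Y w|; last by rewrite mulr0 addr0 ltW.
  rewrite -(real_normK (num_real (Y w))) (@le_trans _ _ (e^-1 * `|Y w| ^+ 2))//.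
    by rewrite mulrC ler_pdivlMr// expr2 ler_wpM2l.
  by rewrite lerDr ltW.
have key : Ex (fun w => Y w * f (V w + Y w)) =
    Ex r1 + Ex (fun w => Y w * f (V w)) +
    (Ex (fun w => capped_sqr (Y w) * f' (V w)) + Ex (fun w => Q2 w * f' (V w))).
  have itau := Lfun2_mul tau2 f'V2.
  transitivity (Ex (fun w => (r1 w + Y w * f (V w)) +
      (capped_sqr (Y w) * f' (V w) + Q2 w * f' (V w)))).
    by apply: eq_Rintegral => w _; rewrite /r1 /Q2; ring.
  by rewrite (ExD (has_meanD ir1 iYfV) (has_meanD itau iQ2f')) (ExD ir1 iYfV) (ExD itau iQ2f').
have vtau : v = Ex (fun w => capped_sqr (Y w)) + Ex Q2.
  rewrite -ExD//; last exact: Lfun2_has_mean.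
  by apply: eq_Rintegral => w _; rewrite /Q2; ring.
have qe : q <= q / e by rewrite ler_pdivlMr// ler_piMr.
rewrite key.
move: (Ex r1) (Ex (fun w => Y w * f (V w))) (Ex (fun w => capped_sqr (Y w) * f' (V w)))
  (Ex (fun w => Q2 w * f' (V w))) (Ex (fun w => f' (V w + Y w))) (Ex (fun w => f' (V w)))
  (Ex (fun w => capped_sqr (Y w))) (Ex Q2) (rcov P Y V) r1b c1 c2 q2f f'Vb f'WV vtau q2b.
clear - v0 q0 C0 e0 e1 v1 qe.
move=> r a t b mW mV s q2 c hr ha ht hb hmV hmW hv /andP[q20 q2q].
have -> : r + a + (t + b) - v * mW = r + a + (t - s * mV) + b - q2 * mV - v * (mW - mV).
  by rewrite hv; ring.
have hx : `|q2 * mV| <= C * q.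
  by rewrite normrM (ger0_norm q20) mulrC ler_pM.
have hy : `|v * (mW - mV)| <= C * (e * v + q / e).
  rewrite normrM (ger0_norm v0); apply: (@le_trans _ _ (v * (C * (e + q / e)))).
    by rewrite ler_wpM2l.
  have -> : v * (C * (e + q / e)) = C * (e * v + v * (q / e)) by ring.
  by rewrite ler_wpM2l// lerD2l ler_piMl// divr_ge0// ltW.
have hb' : `|b| <= C * q by apply: le_trans hb _; rewrite ler_wpM2l.
have hq : C * q <= C * (q / e) by rewrite ler_wpM2l.
apply: le_trans (ler_normB _ _) _.
apply: (@le_trans _ _ (C * (e * v + 2 * q) + C * c + 2 * C * c + C * q + C * q
    + C * (e * v + q / e))); last by lra.
apply: lerD => //; apply: le_trans (ler_normB _ _) _; apply: lerD => //.
do 3 (apply: le_trans (ler_normD _ _) _; apply: lerD => //).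
Qed.

End stein_block.

(** * Stein's estimate for a sum of blocks *)

Section stein_sum.
Context d (T : measurableType d) (R : realType) (P : probability T R).
Local Notation L2 := (Lfun P 2%:E).
Local Notation Ex F := (Rintegral P setT F).

Lemma pqd_rcov_ge0 (U V : T -> R) : pqd P U V -> U \in L2 -> V \in L2 -> 0 <= rcov P U V.
Proof.
move=> UV U2 V2; apply: (@pqd_square_integrable _ _ _ _ U V id id) => //.
- exact: Lfun2_measurable U2.
- exact: Lfun2_measurable V2.
Qed.

(** Summing [stein_block] over the blocks produces the sum of the covariances
    Cov (Y i, W - Y i).  It is equal to Var W - Cov (Rn, W) - sum_i Var (Y i),
    hence at most 1 - sum_i Var (Y i). *)
Lemma stein_sum (m : nat) (Y : 'I_m -> T -> R) (Rn W : T -> R)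
    (f f' : R -> R) (C e : R) :
  (forall w : R, is_derive w 1 f (f' w)) ->
  (forall w, `|f w| <= C) -> (forall w, `|f' w| <= C) -> lipschitz C f' ->
  0 < e <= 1 ->
  (forall i, Y i \in L2) -> Rn \in L2 -> (forall i, Ex (Y i) = 0) ->
  (forall w, W w = \sum_(i < m) Y i w + Rn w) ->
  (forall i, pqd P (Y i) (fun w => W w - Y i w)) -> pqd P Rn W ->
  rcov P W W = 1 ->
  `| Ex (fun w => f' (W w) - W w * f (W w)) | <=
  C * (3 * e + 4 * (1 - \sum_(i < m) Ex (fun w => Y i w ^+ 2))
      + (5 * (\sum_(i < m) Ex (lindeberg_tail e (Y i))) + Ex (fun w => Rn w ^+ 2)) / e).
Proof.
move=> df fC f'C lf' e01 Y2 R2 Y0 WE YW RW W1.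
have /andP[e0 e1] := e01.
have C0 : 0 <= C by apply: le_trans (fC 0).
have lf := derive_bounded_lipschitz df f'C.
have W2 : W \in L2.
  rewrite (_ : W = fun w => \sum_(i < m) Y i w + Rn w); last exact/funext.
  by apply: Lfun2D => //; exact: Lfun2_sum.
have fW2 := lipschitz_Lfun2 lf W2.
have f'W2 := lipschitz_Lfun2 lf' W2.
pose V i w := W w - Y i w.
have V2 i : V i \in L2 by exact: Lfun2B.
have WV i w : V i w + Y i w = W w by rewrite /V subrK.
pose v i := Ex (fun w => Y i w ^+ 2).
pose q i := Ex (lindeberg_tail e (Y i)).
pose c i := rcov P (Y i) (V i).
have vE i : v i = rcov P (Y i) (Y i).
  rewrite /rcov Y0 mul0r subr0; apply: eq_Rintegral => w _.
  by rewrite expr2.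
have c0 i : 0 <= c i by apply: pqd_rcov_ge0 => //; exact: YW.
have v0 i : 0 <= v i by apply: Ex_ge0 => w; exact: sqr_ge0.
have RW0 : 0 <= rcov P Rn W by exact: pqd_rcov_ge0.
have csum : \sum_(i < m) c i + \sum_(i < m) v i + rcov P Rn W = 1.
  rewrite -W1 [in RHS](_ : rcov P W W = rcov P (fun w => \sum_(i < m) Y i w + Rn w) W); last first.
    by congr (rcov P _ W); apply/funext.
  rewrite rcovDl//; last exact: Lfun2_sum.
  rewrite rcov_suml// -big_split/=; congr (_ + _); apply: eq_bigr => i _.
  by rewrite vE -rcovDr//; congr (rcov P _ _); apply/funext => w; exact: WV.
have sc0 : 0 <= \sum_(i < m) c i by apply: sumr_ge0.
have vsum : \sum_(i < m) v i <= 1 by lra.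
have csum1 : \sum_(i < m) c i <= 1 - \sum_(i < m) v i by lra.
have v1 i : v i <= 1.
  apply: le_trans vsum; rewrite (bigD1 i)//= lerDl.
  by apply: sumr_ge0.
pose z := Ex (fun w => f' (W w)).
pose a i := Ex (fun w => Y i w * f (W w)).
have block i : `|a i - v i * z| <= C * (2 * e * v i + 3 * c i + 5 * (q i / e)).
  have := stein_block df fC f'C lf' e01 (Y2 i) (V2 i) (YW i) (Y0 i) (v1 i).
  by under [X in Ex X - _]eq_fun do rewrite WV; under [X in _ * Ex X]eq_fun do rewrite WV.
have iYf i : has_mean P (fun w => Y i w * f (W w)) by exact: Lfun2_mul.
have iRf : has_mean P (fun w => Rn w * f (W w)) by exact: Lfun2_mul.
pose r := Ex (fun w => Rn w * f (W w)).
have rb : `|r| <= C * (e + Ex (fun w => Rn w ^+ 2) / e).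
  have iR2 := Lfun2_sqr R2.
  have ib := has_meanD (has_mean_cst P e) (has_meanZ e^-1 iR2).
  have -> : C * (e + Ex (fun w => Rn w ^+ 2) / e) =
      Ex (fun w => C * (e + e^-1 * Rn w ^+ 2)).
    rewrite (ExZ _ ib) (ExD (has_mean_cst P e) (has_meanZ e^-1 iR2)) (ExZ _ iR2) Ex_cst.
    by rewrite [e^-1 * _]mulrC.
  apply: normr_Ex => //; first exact: has_meanZ.
  move=> w; rewrite normrM mulrC ler_pM//.
  rewrite -(ler_pM2l e0) mulrDr mulrA mulfV ?gt_eqF// mul1r.
  rewrite -(real_normK (num_real (Rn w))).
  have := sqr_ge0 (`|Rn w| - e); have := normr_ge0 (Rn w); nra.
have key : Ex (fun w => f' (W w) - W w * f (W w)) =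
    (1 - \sum_(i < m) v i) * z - \sum_(i < m) (a i - v i * z) - r.
  rewrite ExB; [|exact: Lfun2_has_mean|exact: Lfun2_mul].
  have -> : Ex (fun w => W w * f (W w)) = \sum_(i < m) a i + r.
    rewrite -Ex_sum// -ExD//; last exact: has_mean_sum.
    by apply: eq_Rintegral => w _; rewrite {1}WE mulrDl mulr_suml.
  rewrite sumrB -mulr_suml -/z; ring.
have zb : `|z| <= C.
  rewrite -[leRHS](Ex_cst P C); apply: normr_Ex => //.
  - exact: Lfun2_has_mean.
  - exact: has_mean_cst.
have sb : `|\sum_(i < m) (a i - v i * z)| <=
    C * (2 * e * \sum_(i < m) v i + 3 * \sum_(i < m) c i + 5 * ((\sum_(i < m) q i) / e)).
  apply: le_trans (ler_norm_sum _ _ _) _.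
  apply: le_trans (ler_sum _ (fun i _ => block i)) _.
  by rewrite -mulr_sumr 2!big_split/= -!mulr_sumr mulr_suml.
have sq0 : 0 <= \sum_(i < m) q i.
  by apply: sumr_ge0 => i _; apply: Ex_ge0 => w; exact: lindeberg_tail_ge0.
rewrite key.
apply: le_trans (ler_normB _ _) _; apply: le_trans (lerD (ler_normB _ _) rb) _.
apply: le_trans (lerD (lerD (lexx _) sb) (lexx _)) _.
have zb' : `|(1 - \sum_(i < m) v i) * z| <= C * (1 - \sum_(i < m) v i).
  have h : 0 <= 1 - \sum_(i < m) v i by rewrite subr_ge0.
  by rewrite normrM (ger0_norm h) mulrC ler_wpM2r.
apply: le_trans (lerD (lerD zb' (lexx _)) (lexx _)) _.
rewrite -!mulrDr ler_wpM2l// [X in _ <= _ + X]mulrDl.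
have : e * (\sum_(i < m) v i) <= e by rewrite ler_piMr// ltW.
rewrite -mulrA; move: csum1.
have -> : \sum_(i < m) Ex (fun w => Y i w ^+ 2) = \sum_(i < m) v i by [].
have -> : \sum_(i < m) Ex (lindeberg_tail e (Y i)) = \sum_(i < m) q i by [].
lra.
Qed.

End stein_sum.

(** * From smooth test functions to distribution functions *)

Section smooth_step.
Context {R : realType}.

(** A logistic function with a steep enough slope at c: outside of the window
    from c - a to c + a it is within k of the indicator of the half-line. *)
Lemma smooth_step (c a k : R) : 0 < a -> 0 < k -> exists g g' : R -> R,
  [/\ forall w : R, is_derive w 1 g (g' w),
      exists K, forall w, `|g' w| <= K,
      forall w, `|g w| <= 1,
      forall w, g w <= \1_`]-oo, c + a] w + k &
      forall w, \1_`]-oo, c - a] w <= g w + k].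
Proof.
move=> a0 k0.
(* The slope at which 1 + N * a >= 1 / k, so that expR (N * a) >= 1 / k. *)
pose N := (k * a)^-1.
have N0 : 0 < N by rewrite invr_gt0 mulr_gt0.
pose E (w : R) := expR (N * (w - c)).
have E0 w : 0 < E w by exact: expR_gt0.
have E1 w : 0 < 1 + E w by rewrite addr_gt0.
pose g w := (1 + E w)^-1.
pose g' w := - (1 + E w) ^- 2 * (N * E w).
have Ek w : a <= w - c -> k^-1 <= E w.
  move=> h; apply: le_trans (expR_ge1Dx _).
  have -> : k^-1 = N * a by rewrite /N invfM mulrAC -mulrA mulfV ?mulr1// gt_eqF.
  have := ler_wpM2l (ltW N0) h; lra.
have Ek' w : w - c <= - a -> E w <= k.
  move=> h; rewrite /E -[N * _]opprK expRN -mulrN -[leRHS]invrK.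
  rewrite lef_pV2 ?posrE ?expR_gt0 ?invr_gt0//.
  have -> : expR (N * - (w - c)) = E (c - (w - c)) by rewrite /E; congr (expR (_ * _)); ring.
  by apply: Ek; lra.
have g01 w : 0 < g w <= 1 by rewrite /g invr_gt0 E1/= invf_le1// lerDl ltW.
exists g, g'; split.
- move=> w.
  have dE : is_derive w 1 (fun w => 1 + E w) (N * E w).
    rewrite /E; apply: is_derive_eq.
    by rewrite /GRing.scale/= add0r; ring.
  exact: (@is_deriveV _ (fun w => 1 + E w) w (N * E w) 1 (lt0r_neq0 (E1 w)) dE).
- exists N => w; rewrite /g' normrM normrN !ger0_norm; last 2 first.
  + by rewrite invr_ge0 exprn_ge0// ltW.
  + by rewrite mulr_ge0// ltW.
  rewrite mulrC ler_pdivrMr ?exprn_gt0// ler_pM2l//.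
  have := E0 w; nra.
- by move=> w; have /andP[h1 h2] := g01 w; rewrite ger0_norm// ltW.
- move=> w; rewrite indicE; case: (boolP (w \in _)) => /=.
    by move=> _; have /andP[h1 h2] := g01 w; lra.
  rewrite notin_setE/= in_itv/= => /negP; rewrite -ltNge => h; rewrite add0r.
  rewrite /g -[k]invrK lef_pV2 ?posrE ?invr_gt0//.
  apply: le_trans (Ek w _) _; last by lra.
  by have := E0 w; lra.
- move=> w; rewrite indicE; case: (boolP (w \in _)) => /=; last first.
    by move=> _; have /andP[h1 h2] := g01 w; lra.
  rewrite inE/= in_itv/= => h.
  have h1 : E w <= k by apply: Ek'; lra.
  rewrite -lerBlDr /g -[leRHS]div1r ler_pdivlMr//.
  have := E0 w; nra.
Qed.

Lemma gauss_mean_indic (t : R) :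
  gauss_mean \1_`]-oo, t] = fine (normal_prob (0 : R) 1 `]-oo, t]).
Proof.
rewrite /gauss_mean /normal_prob -/(Rintegral _ _ _) [RHS]Rintegral_mkcond.
apply: eq_Rintegral => w _; rewrite patchE indicE.
by case: ifP; rewrite ?mul1r ?mul0r.
Qed.

Lemma le_gauss_mean (g h : R -> R) (K L : R) :
  measurable_fun [set: R] g -> (forall w, `|g w| <= K) ->
  measurable_fun [set: R] h -> (forall w, `|h w| <= L) ->
  (forall w, g w <= h w) -> gauss_mean g <= gauss_mean h.
Proof.
move=> mg gK mh hL gh; apply: le_Rintegral => //.
- exact: integrable_bounded_phi mg gK.
- exact: integrable_bounded_phi mh hL.
- by move=> w _; rewrite ler_wpM2r// ltW// phi_gt0.
Qed.

Lemma gauss_meanD_cst (g : R -> R) (K k : R) :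
  measurable_fun [set: R] g -> (forall w, `|g w| <= K) ->
  gauss_mean (fun w => g w + k) = gauss_mean g + k.
Proof.
move=> mg gK; rewrite /gauss_mean.
under eq_Rintegral do rewrite mulrDl.
rewrite RintegralD//; last 2 first.
- exact: integrable_bounded_phi mg gK.
- exact: integrable_scale_phi.
rewrite RintegralZl//; last exact: integrable_normal_pdf.
by rewrite Rintegral_phi mulr1.
Qed.

End smooth_step.

Section cdf_convergence.
Context d (T : measurableType d) (R : realType) (P : probability T R).
Local Notation Ex F := (Rintegral P setT F).

Lemma Ex_cdf (Y : {RV P >-> R}) t :
  Ex (\1_`]-oo, t] \o Y) = fine (cdf Y t).
Proof.
rewrite /cdf /distribution /pushforward /=.
rewrite -[in RHS](setIT (_ @^-1` _)) -integral_indic//; last first.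
  by rewrite -[X in measurable X]setTI; exact: measurable_funP.
Qed.

Lemma has_mean_bounded (F : T -> R) k :
  measurable_fun setT F -> (forall w, `|F w| <= k) -> has_mean P F.
Proof. by move=> mF Fk; exact: (le_has_mean mF (has_mean_cst P k)). Qed.

(** The distribution function of Y n at x lies between smooth steps centered at
    x - a and x + a; continuity of the normal distribution function at x makes
    their Gaussian means close to its value at x. *)
Lemma smooth_cvg_in_distribution (Y : nat -> {RV P >-> R}) :
  (forall (h h' : R -> R) (K : R), (forall w : R, is_derive w 1 h (h' w)) ->
     (forall w, `|h w| <= K) -> (forall w, `|h' w| <= K) ->
     Ex (h \o Y n) @[n --> \oo] --> gauss_mean h) ->
  cvg_in_distribution Y (normal_prob 0 1).
Proof.
move=> Yh x cx.
pose F (t : R) : R := fine (normal_prob (0:R) 1 `]-oo, t]).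
have FE t : normal_prob (0:R) 1 `]-oo, t] = (F t)%:E by rewrite fineK// fin_num_measure.
have cF : F t @[t --> x] --> F x.
  by apply: fine_cvg; rewrite -FE; exact: cx.
suff : cdf (Y n) x @[n --> \oo] --> (F x)%:E by rewrite -FE.
apply/fine_cvgP; split.
  by apply: nearW => n; rewrite fin_num_measure.
apply/cvgrPdist_le => e e0.
pose k := e / 4.
have k0 : 0 < k by rewrite divr_gt0.
have /cvgrPdist_le /(_ k k0) /nbhs_ballP[b /= b0 Fb] := cF.
(* The points x - 2 a and x + 2 a both lie in the ball of radius b at x. *)
pose a := b / 4.
have a0 : 0 < a by rewrite divr_gt0.
have /ler_normlP[F1 F2] : `|F x - F (x + 2 * a)| <= k.
  apply: Fb; rewrite /ball/= opprD addNKr normrN ger0_norm; rewrite /a; lra.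
have /ler_normlP[F3 F4] : `|F x - F (x - 2 * a)| <= k.
  apply: Fb; rewrite /ball/= opprB addrC subrK ger0_norm; rewrite /a; lra.
have mI (t : R) : measurable_fun [set: R] (\1_`]-oo, t] : R -> R) by exact: measurable_indic.
have I1 (t w : R) : `|\1_`]-oo, t] w : R| <= 1.
  by rewrite indicE; case: (_ \in _); rewrite ?normr1 ?normr0.
have FI (t : R) : F t = gauss_mean \1_`]-oo, t] by rewrite gauss_mean_indic.
have test (c : R) : exists g, [/\ Ex (g \o Y n) @[n --> \oo] --> gauss_mean g,
   gauss_mean g <= F (c + a) + k, F (c - a) <= gauss_mean g + k,
   forall n, Ex (g \o Y n) <= fine (cdf (Y n) (c + a)) + k &
   forall n, fine (cdf (Y n) (c - a)) <= Ex (g \o Y n) + k].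
  have [g [g' [dg [K g'K] g1 gu gl]]] := smooth_step c a0 k0.
  have cg : continuous g.
    move=> w; apply: differentiable_continuous; apply/derivable1_diffP.
    by have [] := dg w.
  have mg : measurable_fun [set: R] g by exact: continuous_measurable_fun.
  have mgY n : measurable_fun setT (g \o Y n) by exact: measurableT_comp.
  have mIY t n : measurable_fun setT (\1_`]-oo, t] \o Y n : T -> R).
    by apply: measurableT_comp => //; exact: mI.
  have igY n : has_mean P (g \o Y n) by exact: (has_mean_bounded (mgY n) (fun w => g1 (Y n w))).
  have iIY t n : has_mean P (\1_`]-oo, t] \o Y n : T -> R).
    exact: (has_mean_bounded (mIY t n) (fun w => I1 t (Y n w))).
  have gk w : `|g w + k| <= 1 + k.
    by apply: le_trans (ler_normD _ _) _; rewrite lerD// ger0_norm// ltW.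
  have Ik t w : `|\1_`]-oo, t] w + k| <= 1 + k.
    by apply: le_trans (ler_normD _ _) _; rewrite lerD// ger0_norm// ltW.
  exists g; split.
  - apply: (Yh g g' (Num.max 1 K)) => // w; first by rewrite le_max g1.
    by rewrite le_max g'K orbT.
  - rewrite FI -(gauss_meanD_cst _ (mI _) (I1 _)).
    by apply: le_gauss_mean => //; exact: measurable_funD.
  - rewrite FI -(gauss_meanD_cst _ mg g1).
    by apply: le_gauss_mean => //; exact: measurable_funD.
  - move=> n; rewrite -Ex_cdf -[X in _ <= _ + X](Ex_cst P k) -ExD//; last exact: has_mean_cst.
    apply: le_Ex => //; first by apply: has_meanD => //; exact: has_mean_cst.
    by move=> w; exact: gu.
  - move=> n; rewrite -Ex_cdf -[X in _ <= _ + X](Ex_cst P k) -ExD//; last exact: has_mean_cst.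
    apply: le_Ex => //; first by apply: has_meanD => //; exact: has_mean_cst.
    by move=> w; exact: gl.
have [g [gY g1 _ _ g2]] := test (x + a).
have [l [lY _ l1 l2 _]] := test (x - a).
have /cvgrPdist_le /(_ k k0) gYk := gY.
have /cvgrPdist_le /(_ k k0) lYk := lY.
near=> n.
have gYn : `|gauss_mean g - Ex (g \o Y n)| <= k by near: n; exact: gYk.
have lYn : `|gauss_mean l - Ex (l \o Y n)| <= k by near: n; exact: lYk.
have e1 : x + a + a = x + 2 * a by ring.
have e2 : x - a - a = x - 2 * a by ring.
move: (g2 n) (l2 n); rewrite addrK subrK /=.
rewrite e1 in g1; rewrite e2 in l1.
have ek : e = 4 * k by rewrite /k; field.
move: gYn lYn g1 l1 F1 F4; rewrite ek !ler_norml /=.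
move: (F x) (F (x + 2 * a)) (F (x - 2 * a)) (gauss_mean g) (gauss_mean l)
  (fine (cdf (Y n) x)) (Ex (g \o Y n)) (Ex (l \o Y n)).
clearbody k; clear => Fx Fg Fl mg ml c eg el /andP[? ?] /andP[? ?] ? ? ? ? ? ?.
by apply/andP; split; lra.
Unshelve. all: end_near.
Qed.

End cdf_convergence.

(** * Central limit theorem for arrays, and for block sums *)

Section array_clt.
Context d (T : measurableType d) (R : realType) (P : probability T R).
Local Notation L2 := (Lfun P 2%:E).
Local Notation Ex F := (Rintegral P setT F).

(** A Lindeberg theorem for row sums with a negligible extra term Rn.  In place
    of independence in each row it asks for positive quadrant dependence of each
    summand and the sum of the others, and for row variances that add up
    asymptotically to the variance of the row sum. *)
Lemma pqd_array_clt (m : nat -> nat) (Y : forall n, 'I_(m n) -> T -> R)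
    (Rn : nat -> T -> R) (W : nat -> {RV P >-> R}) :
  (forall n, (0 < n)%N -> [/\ forall i, Y n i \in L2, Rn n \in L2,
     forall i, Ex (Y n i) = 0,
     forall w, W n w = \sum_(i < m n) Y n i w + Rn n w & rcov P (W n) (W n) = 1]) ->
  (forall n, (0 < n)%N -> (forall i, pqd P (Y n i) (fun w => W n w - Y n i w)) /\
     pqd P (Rn n) (W n)) ->
  \sum_(i < m n) Ex (fun w => Y n i w ^+ 2) @[n --> \oo] --> (1 : R) ->
  (forall e, 0 < e ->
     \sum_(i < m n) Ex (lindeberg_tail e (Y n i)) @[n --> \oo] --> (0 : R)) ->
  Ex (fun w => Rn n w ^+ 2) @[n --> \oo] --> (0 : R) ->
  cvg_in_distribution W (normal_prob 0 1).
Proof.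
move=> hL2 hpqd hvar hlin hR.
apply: smooth_cvg_in_distribution => h h' K dh hK h'K.
have [f [f' [f'' [C [df df' fE fC]]]]] := stein_equation dh hK h'K.
have f0 w : `|f w| <= C by have [] := fC w.
have f1 w : `|f' w| <= C by have [] := fC w.
have f2 w : `|f'' w| <= C by have [] := fC w.
have C0 : 0 <= C by apply: le_trans (f0 0).
have lf := derive_bounded_lipschitz df f1.
have lf' := derive_bounded_lipschitz df' f2.
have lh := derive_bounded_lipschitz dh h'K.
apply/cvgrPdist_le => eta eta0.
(* The coefficient 3 * C * e of the bound in stein_sum is at most eta / 2. *)
pose e := Num.min 1 (eta / (6 * (C + 1))).
have C1 : 0 < 6 * (C + 1) by lra.
have e0 : 0 < e by rewrite lt_min ltr01 divr_gt0.
have e1 : e <= 1 by rewrite ge_min lexx.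
have eC : C * (3 * e) <= eta / 2.
  have : e <= eta / (6 * (C + 1)) by rewrite ge_min lexx orbT.
  by rewrite ler_pdivlMr//; nra.
have bound_cvg : C * (3 * e + 4 * (1 - \sum_(i < m n) Ex (fun w => Y n i w ^+ 2))
      + (5 * (\sum_(i < m n) Ex (lindeberg_tail e (Y n i)))
         + Ex (fun w => Rn n w ^+ 2)) / e) @[n --> \oo] -->
    C * (3 * e + 4 * (1 - 1) + (5 * 0 + 0) / e).
  apply: cvgM; first exact: cvg_cst.
  apply: cvgD.
    apply: cvgD; first exact: cvg_cst.
    by apply: cvgM; [exact: cvg_cst|apply: cvgB => //; exact: cvg_cst].
  apply: cvgM; last exact: cvg_cst.
  by apply: cvgD => //; apply: cvgM; [exact: cvg_cst|exact: hlin].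
have eta2 : 0 < eta / 2 by rewrite divr_gt0.
have /cvgrPdist_le /(_ (eta / 2) eta2) near_bound := bound_cvg.
near=> n.
have n0 : (0 < n)%N by near: n; exists 1%N.
have [Y2 R2 Y0 WE W1] := hL2 n n0.
have [YW RW] := hpqd n n0.
have e01 : 0 < e <= 1 by rewrite e0 e1.
have W2 : (W n : T -> R) \in L2.
  rewrite (_ : (W n : T -> R) = fun w => \sum_(i < m n) Y n i w + Rn n w); last exact/funext.
  by apply: Lfun2D => //; exact: Lfun2_sum.
have ihW := Lfun2_has_mean (lipschitz_Lfun2 lh W2).
have := stein_sum df f0 f1 lf' e01 Y2 R2 Y0 WE YW RW W1.
under [X in `|Ex X|]eq_fun do rewrite fE.
rewrite (ExB ihW (has_mean_cst P _)) Ex_cst distrC => stein_le.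
apply: le_trans stein_le _.
have : `|C * (3 * e + 4 * (1 - 1) + (5 * 0 + 0) / e) -
  C * (3 * e + 4 * (1 - \sum_(i < m n) Ex (fun w => Y n i w ^+ 2))
      + (5 * (\sum_(i < m n) Ex (lindeberg_tail e (Y n i)))
         + Ex (fun w => Rn n w ^+ 2)) / e)| <= eta / 2 by near: n.
rewrite ler_norml subrr mulr0 mulr0 addr0 addr0 mul0r addr0 => /andP[+ _].
move: eC; lra.
Unshelve. all: end_near.
Qed.

End array_clt.

Section block_sums.
Context d (T : measurableType d) (R : realType) (P : probability T R).
Local Notation L2 := (Lfun P 2%:E).
Local Notation Ex F := (Rintegral P setT F).
Context (X : nat -> {RV P >-> R}).
Implicit Types a b c : nat.

Lemma block_sum_cat a b c w : (a <= b <= c)%N ->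
  block_sum X a c w = block_sum X a b w + block_sum X b c w.
Proof. by move=> /andP[ab bc]; rewrite /block_sum (big_cat_nat (n := b.+1)). Qed.

Lemma block_sum_blocks a l m w :
  block_sum X a (a + m * l) w =
  \sum_(i < m) block_sum X (a + i * l) (a + i.+1 * l) w.
Proof.
elim: m => [|m IH]; first by rewrite big_ord0 addn0 /block_sum big_geq.
rewrite big_ord_recr/= -IH -block_sum_cat//; lia.
Qed.

Lemma block_sum_weights a b N w : (b <= N)%N ->
  block_sum X a b w = \sum_(i < N) ((a <= i < b)%N)%:R * X i.+1 w.
Proof.
move=> bN; rewrite /block_sum big_add1/=.
under [RHS]eq_bigr do rewrite mulr_natl mulrb.
rewrite -big_mkcond/= -(big_mkord (fun i => (a <= i < b)%N) (fun i => X i.+1 w)).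
rewrite (big_nat_widen _ _ _ _ _ bN) (big_nat_widenl a 0)//.
by apply: eq_bigl => i; lia.
Qed.

Context (X_L2 : forall j, (1 <= j)%N -> (X j : T -> R) \in L2)
  (X_centered : forall j, (1 <= j)%N -> ('E_P[X j] = 0)%E).

Lemma block_sum_Lfun2 a b : (block_sum X a b : T -> R) \in L2.
Proof.
rewrite /block_sum; under eq_fun do rewrite big_add1/=.
by apply: Lfun2_sum => i _; exact: X_L2.
Qed.

Lemma block_sum_centered a b : Ex (block_sum X a b) = 0.
Proof.
rewrite /block_sum; under eq_Rintegral do rewrite big_add1/=.
rewrite Ex_sum; last by move=> i _; exact/Lfun2_has_mean/X_L2.
rewrite big1// => i _.
by have := @X_centered i.+1 isT; rewrite unlock /Rintegral => ->.
Qed.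

Lemma block_sum_variance a b k :
  ((k ^+ 2)%:E * 'V_P[block_sum X a b])%E =
  (Ex (fun w => (k * block_sum X a b w) ^+ 2))%:E.
Proof.
have B2 := block_sum_Lfun2 a b.
rewrite /variance covariance_rcov// -EFinM; congr EFin.
rewrite /rcov block_sum_centered mul0r subr0.
under [RHS]eq_Rintegral do rewrite exprMn.
rewrite ExZ; last exact: Lfun2_sqr.
by congr (_ * _); apply: eq_Rintegral => w _; rewrite expr2.
Qed.

(** The second variable is a combination of the X i with nonnegative weights
    because the indices of the third block are among those of the second one. *)
Lemma associated_block_pqd k a b a' b' a'' b'' :
  associated X -> 0 <= k -> 
  (forall i, (a'' <= i < b'')%N -> (a' <= i < b')%N) ->
  pqd P (fun w => k * block_sum X a b w)
        (fun w => k * block_sum X a' b' w - k * block_sum X a'' b'' w).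
Proof.
move=> aX k0 sub.
pose N := (b + b' + b'')%N.
have bN : (b <= N)%N by rewrite /N; lia.
have b'N : (b' <= N)%N by rewrite /N; lia.
have b''N : (b'' <= N)%N by rewrite /N; lia.
have -> : (fun w => k * block_sum X a b w) =
    (fun w => \sum_(i < N) (k * (a <= i < b)%N%:R) * X i.+1 w).
  apply/funext => w; rewrite (block_sum_weights a w bN) mulr_sumr.
  by apply: eq_bigr => i _; rewrite mulrA.
have -> : (fun w => k * block_sum X a' b' w - k * block_sum X a'' b'' w) =
    (fun w => \sum_(i < N) (k * ((a' <= i < b')%N%:R - (a'' <= i < b'')%N%:R)) * X i.+1 w).
  apply/funext => w; rewrite (block_sum_weights a' w b'N) (block_sum_weights a'' w b''N).
  rewrite !mulr_sumr -sumrB.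
  by apply: eq_bigr => i _; ring.
apply: (@associated_pqd _ _ _ _ X N (fun i => k * (a <= i < b)%N%:R)
  (fun i => k * ((a' <= i < b')%N%:R - (a'' <= i < b'')%N%:R)) aX).
- by move=> i; rewrite mulr_ge0.
- move=> i; rewrite mulr_ge0// subr_ge0 ler_nat.
  by have := sub i; case: (a'' <= i < b'')%N => // ->.
Qed.

(** On |Y| >= e one has Y^2 <= |Y|^(2 + delta) / e^delta. *)
Lemma lindeberg_tail_moment (D : {RV P >-> R}) (s delta e : R) :
  0 < s -> 0 < delta -> 0 < e -> (D : T -> R) \in L2 ->
  ((Ex (lindeberg_tail e (fun w => s^-1 * D w)))%:E <=
   (e `^ delta)^-1%:E * ((s `^ (2 + delta))^-1%:E *
     'E_P[(fun w => `|D w| `^ (2 + delta))%R]))%E.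
Proof.
move=> s0 d0 e0 D2.
have Y2 : (fun w => s^-1 * D w) \in L2 by exact: Lfun2Z.
have iQ := has_mean_lindeberg_tail e Y2.
have mpow : measurable_fun setT (fun w => `|D w| `^ (2 + delta)).
  apply: (measurableT_comp (measurable_powR _)) => //.
  exact: measurableT_comp.
rewrite /Rintegral fineK; last exact: integrable_fin_num iQ.
rewrite unlock muleA -EFinM -ge0_integralZl_EFin//; last 2 first.
- exact/measurable_EFinP.
- by rewrite mulr_ge0// invr_ge0 powR_ge0.
apply: ge0_le_integral => //.
- by move=> w _; rewrite lee_fin lindeberg_tail_ge0.
- by apply/measurable_EFinP; exact: has_mean_measurable iQ.
- by apply/measurable_EFinP; apply: measurable_funM.
move=> w _; rewrite -EFinM lee_fin /lindeberg_tail.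
case: ifPn => [eY|_]; last by rewrite !mulr_ge0 ?invr_ge0 ?powR_ge0.
have Y0 : 0 < `|s^-1 * D w| by apply: lt_le_trans eY.
have -> : `|D w| = s * `|s^-1 * D w|.
  by rewrite normrM (gtr0_norm (x := s^-1)) ?invr_gt0// mulrA mulfV ?mul1r// gt_eqF.
rewrite powRM ?(ltW s0)// -mulrA mulKf; last by rewrite gt_eqF// powR_gt0.
have y0 : s^-1 * D w != 0 by rewrite -normr_gt0.
rewrite powRD ?normr_eq0 ?y0 ?implybT// mulrCA -[2]/(2%:R) powR_mulrn// real_normK ?num_real//.
rewrite ler_peMr ?sqr_ge0// mulrC ler_pdivlMr ?powR_gt0// mul1r.
by apply: (ge0_ler_powR (ltW d0)); rewrite ?nnegrE ?(ltW e0)// normr_ge0.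
Qed.

End block_sums.

Lemma moment_Lfun2 d (T : measurableType d) (R : realType) (P : probability T R)
    (Z : {RV P >-> R}) (delta : R) : 0 < delta ->
  ('E_P[(fun w => `|Z w| `^ (2 + delta))%R] < +oo)%E ->
  (Z : T -> R) \in Lfun P 2%:E.
Proof.
move=> d0; rewrite unlock => Zoo.
apply: (@Lfun_subset _ _ _ P 2%:E (2 + delta)%:E); rewrite ?lee1n ?lee_fin//.
- by lra.
- exact: fin_num_measure.
- by rewrite lerDl ltW.
rewrite inE; apply/andP; split; rewrite inE//=.
by rewrite /finite_norm unlock /Lnorm poweR_lty.
Qed.

Theorem theorem4 (d : measure_display) (T : measurableType d) (R : realType)
  (P : probability T R) (X : nat -> {RV P >-> R}) (p : nat -> nat) (delta : R)
  (l m r : nat -> nat) (s : nat -> R)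
  (S' := fun n : nat => block_sum X (p n) (n + p n) : {RV P >-> R})
  (D := fun j n : nat =>
          block_sum X (p n + (j - 1) * l n) (p n + j * l n) : {RV P >-> R})
  (X_assoc : associated X)
  (X_centered : forall j, (1 <= j)%N -> ('E_P[X j] = 0)%E)
  (delta_gt0 : 0 < delta)
  (X_moment : forall j, (1 <= j)%N ->
    ('E_P[(fun w => `|X j w| `^ (2 + delta))%R] < +oo)%E)
  (l_ge1 : forall n, (1 <= n)%N -> (1 <= l n)%N)
  (n_decomp : forall n, (1 <= n)%N -> n = (m n * l n + r n)%N)
  (r_lt : forall n, (1 <= n)%N -> (r n < l n)%N)
  (m_infty : m n @[n --> \oo] --> \oo)
  (s_gt0 : forall n, (1 <= n)%N -> 0 < s n)
  (s_var : forall n, (1 <= n)%N -> (((s n) ^+ 2)%:E = 'V_P[S' n])%E)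
  (L : (l n)%:R / n%:R @[n --> \oo] --> (0 : R))
  (H0 : (l n)%:R / (s n) ^+ 2 @[n --> \oo] --> (0 : R))
  (Ha : (((s n) ^+ 2)^-1%:E * \sum_(1 <= j < (m n).+1) 'V_P[D j n])%E
          @[n --> \oo] --> 1%E)
  (Hab : (((s n) ^+ 2)^-1%:E *
            'V_P[block_sum X (p n + m n * l n) (p n + n)])%E
          @[n --> \oo] --> 0%E)
  (Hb : ereal_sup [set (((s n) ^+ 2)^-1%:E * 'V_P[D j n])%E
                    | j in [set j | (1 <= j <= m n)%N]]
          @[n --> \oo] --> 0%E)
  (Hc : ((s n `^ (2 + delta))^-1%:E *
           \sum_(1 <= j < (m n).+1)
              'E_P[(fun w => `|D j n w| `^ (2 + delta))%R])%E
          @[n --> \oo] --> 0%E) :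
  cvg_in_distribution (fun n => (s n)^-1 \o* S' n : {RV P >-> R})
    (normal_prob 0 1).
Proof.
have X2 j : (1 <= j)%N -> (X j : T -> R) \in Lfun P 2%:E.
  by move=> j1; exact: moment_Lfun2 delta_gt0 (X_moment j j1).
have B2 a b : (block_sum X a b : T -> R) \in Lfun P 2%:E by exact: block_sum_Lfun2.
pose Y n (i : 'I_(m n)) (w : T) := (s n)^-1 * D i.+1 n w.
pose Rn n (w : T) := (s n)^-1 * block_sum X (p n + m n * l n) (p n + n) w.
have mln n : (0 < n)%N -> (m n * l n <= n)%N.
  by move=> n0; rewrite [leqRHS](n_decomp n n0) leq_addr.
have blockE n (i : 'I_(m n)) : D i.+1 n =
    block_sum X (p n + i * l n) (p n + i.+1 * l n) :> (T -> R).
  by rewrite /D subn1.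
have YE n i : Y n i = fun w => (s n)^-1 * block_sum X (p n + i * l n) (p n + i.+1 * l n) w.
  by rewrite /Y blockE.
have WE n : (0 < n)%N -> (((s n)^-1 \o* S' n : {RV P >-> R}) : T -> R) =
    fun w => (s n)^-1 * block_sum X (p n) (p n + n) w.
  by move=> n0; apply/funext => w /=; rewrite mulrC addnC.
have subn (n : nat) (i : 'I_(m n)) k : (0 < n)%N ->
    (p n + i * l n <= k < p n + i.+1 * l n)%N -> (p n <= k < p n + n)%N.
  move=> n0 /andP[k1 k2]; rewrite (leq_trans _ k1) ?leq_addr//=.
  apply: (leq_trans k2); rewrite leq_add2l (leq_trans _ (mln n n0))//.
  by rewrite leq_mul2r ltn_ord orbT.
apply: (@pqd_array_clt _ _ _ P m Y Rn) => [n n0|n n0|||].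
- split.
  + by move=> i; apply: Lfun2Z; exact: B2.
  + by apply: Lfun2Z; exact: B2.
  + move=> i; rewrite ExZ; last exact/Lfun2_has_mean/B2.
    by rewrite block_sum_centered// mulr0.
  + move=> w; rewrite WE// (@block_sum_cat _ _ _ _ _ _ (p n + m n * l n)); last first.
      by rewrite leq_addr leq_add2l mln.
    rewrite mulrDr block_sum_blocks mulr_sumr; congr (_ + _).
    by apply: eq_bigr => i _; rewrite /Y blockE.
  + have s0 := s_gt0 n n0.
    have := s_var n n0; rewrite /variance covariance_rcov; [|exact: B2|exact: B2].
    move=> [sE]; rewrite WE// rcovZl ?rcovZr ?Lfun2Z//.
    rewrite addnC in sE; rewrite /S' in sE.
    by rewrite -sE mulrA -expr2 -exprMn mulVf ?expr1n// gt_eqF.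
- have s0 : 0 <= (s n)^-1 by rewrite invr_ge0 ltW// s_gt0.
  split=> [i|].
  + rewrite WE// YE.
    exact: (associated_block_pqd _ _ X_assoc s0 (fun k => @subn n i k n0)).
  (* W is the full block minus the empty block from 0 to 0. *)
  + have no k : (0 <= k < 0)%N -> (p n <= k < p n + n)%N by rewrite ltn0 andbF.
    rewrite WE//; have := associated_block_pqd (p n + m n * l n) (p n + n)
      X_assoc s0 no.
    rewrite (_ : (fun w => _ - _) = (fun w => (s n)^-1 * block_sum X (p n) (p n + n) w))//.
    by apply/funext => w; rewrite [block_sum X 0 0 w]big_geq// mulr0 subr0.
- have varE n : (((s n) ^+ 2)^-1%:E * \sum_(1 <= j < (m n).+1) 'V_P[D j n])%E =
      (\sum_(i < m n) (Rintegral P setT) (fun w => Y n i w ^+ 2))%:E.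
    rewrite big_add1/= big_mkord ge0_sume_distrr; last first.
      by move=> i _; exact: variance_ge0.
    rewrite -sumEFin; apply: eq_bigr => i _.
    by rewrite -exprVn block_sum_variance.
  by rewrite (funext varE) in Ha; exact: (fine_cvg Ha).
- move=> e e0.
  have bound n : (0 < n)%N ->
      (0 <= (\sum_(i < m n) (Rintegral P setT) (lindeberg_tail e (Y n i)))%:E <=
      (e `^ delta)^-1%:E * ((s n `^ (2 + delta))^-1%:E *
           \sum_(1 <= j < (m n).+1)
              'E_P[(fun w => `|D j n w| `^ (2 + delta))%R]))%E.
    move=> n0; apply/andP; split.
      rewrite lee_fin; apply: sumr_ge0 => i _; apply: Ex_ge0 => w.
      exact: lindeberg_tail_ge0.
    have E0 j : (0 <= 'E_P[(fun w => `|D j n w| `^ (2 + delta))%R])%E.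
      by apply: expectation_ge0 => w; exact: powR_ge0.
    rewrite big_add1/= big_mkord ge0_sume_distrr; last by move=> i _; exact: E0.
    rewrite ge0_sume_distrr; last first.
      by move=> i _; apply: mule_ge0; [rewrite lee_fin invr_ge0 powR_ge0|exact: E0].
    rewrite -sumEFin; apply: lee_sum => i _.
    exact: (lindeberg_tail_moment (s_gt0 n n0) delta_gt0 e0 (B2 _ _)).
  suff h : (\sum_(i < m n) (Rintegral P setT) (lindeberg_tail e (Y n i)))%:E
      @[n --> \oo] --> 0%E by exact: (fine_cvg h).
  apply: (@squeeze_cvge _ _ _ _ (cst 0%E) _ (fun n =>
      (e `^ delta)^-1%:E * ((s n `^ (2 + delta))^-1%:E *
           \sum_(1 <= j < (m n).+1)
              'E_P[(fun w => `|D j n w| `^ (2 + delta))%R])))%E.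
  + by near=> n; apply: bound; near: n; exists 1%N.
  + exact: cvg_cst.
  + rewrite -[X in _ --> X](mule0 (e `^ delta)^-1%:E).
    by apply: cvgeZl.
- have varE n : (((s n) ^+ 2)^-1%:E * 'V_P[block_sum X (p n + m n * l n) (p n + n)])%E =
      ((Rintegral P setT) (fun w => Rn n w ^+ 2))%:E.
    by rewrite -exprVn block_sum_variance.
  by rewrite (funext varE) in Hab; exact: (fine_cvg Hab).
Unshelve. all: end_near.
Qed.
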